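(* For every real $\epsilon>0$ and every positive integer $t$ there exists a real $\gamma>0$ such that the following holds. Let $D>0$ be a real number and let $G$ be a finite graph with vertex partition $V(G)=V_1\cup\dots\cup V_m$ whose local degree (with respect to this partition) is at most $\gamma D$. Suppose that $|V_i|\ge (1+\epsilon)\frac{D}{t}$ and $\bar{d}_G(V_i)\le D$ for each $i\in\{1,\dots,m\}$. Then $G$ has a $K_{t+1}$-free transversal with respect to $V_1,\dots,V_m$.
   Context: Graphs are finite and simple. Given a graph $G$ and a partition $V(G)=V_1\cup\dots\cup V_m$ of its vertex set: - A $K_{t+1}$-free transversal is a set $T$ containing exactly one vertex from each part $V_i$ such that the induced subgraph $G[T]$ contains no complete graph $K_{t+1}$ on $t+1$ vertices. - For $i\ne j$, $G[V_i,V_j]$ denotes the bipartite subgraph of $G$ with vertex set $V_i\cup V_j$ consisting of all edges of $G$ with one endpoint in $V_i$ and the other in $V_j$. The local degree of $G$ (with respect to $\{V_i\}$) is the maximum, over all distinct $i,j$, of the maximum degree $\Delta(G[V_i,V_j])$. - For nonempty $U\subseteq V(G)$, the average degree of $U$ in $G$ is $\bar{d}_G(U):=\frac{1}{|U|}\sum_{u\in U}d_G(u)$, where $d_G(u)$ is the degree of $u$ in $G$. *)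

(* Defs.v *)
From HB Require Import structures.
From mathcomp Require Import all_boot all_order all_algebra.
From mathcomp Require Import reals.

Set Implicit Arguments.
Unset Strict Implicit.
Unset Printing Implicit Defensive.

Import Order.TTheory GRing.Theory Num.Theory.
Local Open Scope ring_scope.

Definition simple_graph (T : finType) (e : rel T) : Prop :=
  symmetric e /\ irreflexive e.

Definition degree (T : finType) (e : rel T) (x : T) : nat :=
  #|[set y | e x y]|.

(* Empty parts are allowed here; a lower bound on the sizes of the parts has
   to rule them out. *)
Definition vertex_partition (T : finType) (m : nat) (V : 'I_m -> {set T}) :
    Prop :=
  (forall i j, i != j -> [disjoint V i & V j]) /\
  \bigcup_(i < m) V i = [set: T].

Definition bipartite_between (T : finType) (e : rel T) (A B : {set T}) :
    rel T :=
  fun x y => e x y &&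
    ((x \in A) && (y \in B) || (x \in B) && (y \in A)).

Definition max_degree (T : finType) (e : rel T) (W : {set T}) : nat :=
  \max_(x in W) degree e x.

(* An empty maximum is 0, so the local degree is 0 when there are fewer than
   two parts. *)
Definition local_degree (T : finType) (e : rel T) (m : nat)
    (V : 'I_m -> {set T}) : nat :=
  \max_(i < m) \max_(j < m | i != j)
    max_degree (bipartite_between e (V i) (V j)) (V i :|: V j).

Definition average_degree (R : realType) (T : finType) (e : rel T)
    (U : {set T}) : R :=
  (\sum_(u in U) (degree e u)%:R) / #|U|%:R.

Definition transversal_of (T : finType) (m : nat) (V : 'I_m -> {set T})
    (S : {set T}) : Prop :=
  forall i, #|S :&: V i| = 1%N.

Definition is_clique (T : finType) (e : rel T) (K : {set T}) : Prop :=
  {in K &, forall x y, x != y -> e x y}.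

Definition clique_free (T : finType) (e : rel T) (n : nat) (S : {set T}) :
    Prop :=
  ~ exists K : {set T}, [/\ K \subset S, #|K| = n & is_clique e K].

(* Main.v *)
Require Import Defs.
From HB Require Import structures.
From mathcomp Require Import all_boot all_order all_algebra.
From mathcomp Require Import reals sequences exp ring lra.

Set Implicit Arguments.
Unset Strict Implicit.
Unset Printing Implicit Defensive.

Import Order.TTheory GRing.Theory Num.Theory.
Local Open Scope ring_scope.

(** Colour the parts with t colours so that as few edges as possible join two
different parts of the same colour.  Recolouring one part does not help, so
each part sends at most a fraction 1/t of its outgoing edges to other parts of
its colour ([balanced_colouring]).  A transversal without such monochromatic
edges has no clique on t + 1 vertices, by the pigeonhole principle
([transversal_of_picks]).  So it is enough to find an independent transversal
of the graph of monochromatic edges, with D / t in the place of D: this is the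
case t = 1 ([core]).

For t = 1, trim all parts to one size N, a little larger than D, by deleting
vertices of high degree.  Split the parts into T classes, for a large constant
T, such that nearly every vertex sends close to a fraction 1/T of its edges to
each class ([splitting]).  The classes are treated one after the other: a round
picks one vertex from what is left of each part of the class, so that the picks
are pairwise nonadjacent, and deletes the neighbours of the picks from all
parts ([on_track_step], [rounds]).  Inside a class the degrees are of order
D / T, much less than the number of vertices left, so that it is cheap to avoid
edges between picks.  If the picks behave like uniform ones, a vertex of degree
d is deleted with probability about d / (T n_k) in round k, where n_k is the
size to which the parts have shrunk, and a part loses about D / T vertices in
each round; as T D / T = D < N, a constant proportion survives until the turn
of the part comes.

The degrees in a part are bounded only on average, and a vertex of degree
above D survives with less than the typical probability.  Therefore the
quantity to follow is not the number of remaining vertices, but the sum over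
them of the predicted probabilities prod_k (1 - x_v / n_k) that they survive
the remaining rounds, x_v being proportional to the degree of v.  This product
is convex in x_v, hence initially the sum is at least what it would be if all
degrees were equal to their average ([survival_jensen]), and the amount that a
round takes away from it is a sum of contributions of the single picks.

Both the splitting and the rounds choose one value for each of many variables
in such a way that no two choices conflict and that many statistics F_i, one
for each part, all stay below a threshold slightly above their means.  As
local degrees may be as large as gamma D, the failure of one statistic has a
probability that depends on gamma only, whereas it is influenced by a number of
variables that grows with D; so the local lemma does not apply.  Instead
[soft_counting] counts assignments x with the weight prod_i ramp (F_i x), where
the ramp falls from 1 to 0 with slope 1.  One shows by induction that each new
variable multiplies the total weight by almost its number of values.  Suppose
that this holds for smaller sets of variables.  Then every product of one
nonnegative function per variable has, in the weighted average, almost at most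
the value that it has for independent uniform choices ([total_prod_le]), so
that exponential moments show that F_i comes near the threshold only on a
fraction q of the weight.  A new choice u, which increases F_i by at most
w_i u, lowers ramp (F_i) only if F_i is near the threshold, and by at most w_i u.
Thus the loss is at most of the order of q times the sum of all increments,
however small these are and however many i they concern. *)

(** * Weighted counting of partial assignments *)

Section PartialAssignments.

Variables (R : realType) (J U : finType) (X : J -> {set U}).

Definition assign (x : {ffun J -> option U}) (j : J) (u : U) :
    {ffun J -> option U} :=
  [ffun k => if k == j then Some u else x k].

(** The value [None] marks a variable that is not assigned yet.  Assignments of
different sets [S] have one type, so that a weight can be compared before and
after a variable is added. *)
Definition chooses (S : {set J}) (x : {ffun J -> option U}) : bool :=
  [forall j, if j \in S then (if x j is Some u then u \in X j else false)
             else x j == None].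

Definition total (S : {set J}) (h : {ffun J -> option U} -> R) : R :=
  \sum_(x | chooses S x) h x.

Lemma chooses_out (S : {set J}) x j : chooses S x -> j \notin S -> x j = None.
Proof. by move=> /forallP /(_ j) + /negbTE jS; rewrite jS => /eqP. Qed.

Lemma chooses_in (S : {set J}) x j :
  chooses S x -> j \in S -> exists2 u, u \in X j & x j = Some u.
Proof.
move=> /forallP /(_ j) + jS; rewrite jS.
by case: (x j) => // u uX; exists u.
Qed.

Lemma assign_same x j u : assign x j u j = Some u.
Proof. by rewrite ffunE eqxx. Qed.

Lemma assign_other x j u k : k != j -> assign x j u k = x k.
Proof. by move=> kj; rewrite ffunE (negbTE kj). Qed.

Lemma total_set0 h : total set0 h = h [ffun=> None].
Proof.
rewrite /total (big_pred1 [ffun=> None]) // => x /=; apply/forallP/eqP.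
  by move=> H; apply/ffunP=> j; have := H j; rewrite inE ffunE => /eqP.
by move=> -> j; rewrite inE ffunE.
Qed.

Lemma total_step (S : {set J}) j h : j \notin S ->
  total (j |: S) h = \sum_(u in X j) total S (fun x => h (assign x j u)).
Proof.
move=> jS; rewrite /total.
have -> : \sum_(x | chooses (j |: S) x) h x =
    \sum_(x | chooses (j |: S) x)
       \sum_(u in X j) (if x j == Some u then h x else 0).
  apply: eq_bigr => x /chooses_in /(_ (setU11 _ _)) [u uX xj].
  rewrite (bigD1 u) //= xj eqxx big1 ?addr0 // => v /andP[_ vu].
  by case: eqP => // -[] uv; rewrite uv eqxx in vu.
rewrite exchange_big /=; apply: eq_bigr => u uX.
rewrite -big_mkcondr /=.
rewrite (reindex_onto (fun y => assign y j u)
  (fun x => [ffun k => if k == j then None else x k])) /=; last first.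
  move=> x /andP[_ /eqP xj]; apply/ffunP=> k; rewrite !ffunE.
  by case: eqP => // ->; rewrite xj.
apply: eq_bigl => y; rewrite assign_same eqxx andbT.
apply/andP/idP.
  case=> /forallP cy /eqP yE; apply/forallP=> k; have := cy k.
  rewrite !inE; case: (eqVneq k j) => [->|kj] /=.
    by rewrite (negbTE jS) => _; rewrite -yE !ffunE eqxx.
  by rewrite assign_other.
move=> cy; split.
  apply/forallP=> k; rewrite !inE; case: (eqVneq k j) => [->|kj] /=.
    by rewrite assign_same.
  by rewrite assign_other //; exact: (forallP cy k).
apply/eqP/ffunP=> k; rewrite !ffunE; case: eqP => // ->.
by rewrite (chooses_out cy).
Qed.

Lemma total_le S h h' : (forall x, chooses S x -> h x <= h' x) ->
  total S h <= total S h'.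
Proof. by move=> hh'; apply: ler_sum => x; exact: hh'. Qed.

Lemma total_ge0 S h : (forall x, 0 <= h x) -> 0 <= total S h.
Proof. by move=> h0; apply: sumr_ge0. Qed.

Lemma eq_total S h h' : (forall x, chooses S x -> h x = h' x) ->
  total S h = total S h'.
Proof. by move=> hh'; apply: eq_bigr => x; exact: hh'. Qed.

Lemma totalZ S a h : total S (fun x => a * h x) = a * total S h.
Proof. by rewrite /total mulr_sumr. Qed.

Lemma totalD S h h' : total S (fun x => h x + h' x) = total S h + total S h'.
Proof. by rewrite /total big_split. Qed.

Lemma totalB S h h' : total S (fun x => h x - h' x) = total S h - total S h'.
Proof. by rewrite /total -sumrB. Qed.

Lemma total_sum (I : finType) (P : pred I) S (h : I -> _ -> R) :
  total S (fun x => \sum_(i | P i) h i x) = \sum_(i | P i) total S (h i).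
Proof. by rewrite /total exchange_big. Qed.

Definition antitone (wt : {ffun J -> option U} -> R) : Prop :=
  forall (x : {ffun J -> option U}) j u, x j = None -> u \in X j ->
    wt (assign x j u) <= wt x.

Variable beta : J -> R.

(** Read [beta j] as slightly less than the number of values of [j]: each new
variable has to multiply the total weight by at least that much.  Together with
[antitone] this takes the place of uniformity and independence in the tail
estimates. *)
Definition spread (S : {set J}) (wt : {ffun J -> option U} -> R) : Prop :=
  forall (A : {set J}) j, A \subset S -> j \in A ->
    beta j * total (A :\ j) wt <= total A wt.

Definition picked_sum (w : J -> U -> R) (x : {ffun J -> option U}) : R :=
  \sum_j oapp (w j) 0 (x j).

(** For independent uniform choices the product would have the average
[\prod (1 + average of g j)].  To split off one factor [1 + g j u], the
assignments with [x j = Some u] are compared with those where [j] is left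
unassigned: their weight is smaller as [wt] is antitone, and [spread] says that
the total weight without [j] is at most [(beta j)^-1] times the one with [j]. *)
Lemma total_prod_le (S : {set J}) (wt : {ffun J -> option U} -> R)
    (g : J -> U -> R) (l : seq J) : uniq l ->
  (forall x, 0 <= wt x) -> antitone wt -> spread S wt ->
  (forall j, j \in S -> 0 < beta j) -> (forall j u, 0 <= g j u) ->
  forall A : {set J}, A \subset S ->
  total A (fun x => wt x * \prod_(j <- l) (1 + oapp (g j) 0 (x j))) <=
  \prod_(j <- l | j \in S) (1 + (\sum_(u in X j) g j u) / beta j) * total A wt.
Proof.
move=> ul wt0 wta wts b0 g0.
have G0 l' (x : {ffun J -> option U}) : 0 <= \prod_(j <- l') (1 + oapp (g j) 0 (x j)).
  by apply: prodr_ge0 => j _; case: (x j) => /= [u|]; rewrite ?addr_ge0.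
have B0 l' : 0 <= \prod_(j <- l' | j \in S)
    (1 + (\sum_(u in X j) g j u) / beta j).
  apply: prodr_ge0 => j jS; rewrite addr_ge0 // divr_ge0 ?sumr_ge0 //.
  by rewrite ltW // b0.
elim: l ul => [_|j l IH /= /andP[jl ul]] A AS.
  by rewrite big_nil mul1r; apply: total_le => x _; rewrite big_nil mulr1.
have {}IH := IH ul.
have [jA|jA] := boolP (j \in A); last first.
  have -> : total A (fun x => wt x * \prod_(k <- j :: l) (1 + oapp (g k) 0 (x k)))
    = total A (fun x => wt x * \prod_(k <- l) (1 + oapp (g k) 0 (x k))).
    by apply: eq_total => x cx; rewrite big_cons (chooses_out cx jA) addr0 mul1r.
  apply: le_trans (IH A AS) _; rewrite big_cons.
  case: ifP => [jS|_] //; apply: ler_wpM2r; first exact: total_ge0.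
  rewrite ler_peMl // lerDl divr_ge0 ?sumr_ge0 // ltW //.
  exact: b0.
have jS : j \in S by exact: (subsetP AS).
rewrite big_cons jS mulrDl mul1r mulrDl.
have AjS : A :\ j \subset S by apply: subset_trans AS; exact: subsetDl.
have jAj : j \notin A :\ j by rewrite !inE eqxx.
under eq_total => x _ do rewrite big_cons mulrDl mul1r mulrDr.
rewrite totalD lerD //; first exact: IH.
rewrite -{1}(setD1K jA) total_step //.
set B := \prod_(k <- l | k \in S) _.
apply: (@le_trans _ _ (\sum_(u in X j) g j u * (B * total (A :\ j) wt))).
  apply: ler_sum => u uX.
  apply: le_trans (_ : g j u * total (A :\ j)
    (fun x => wt x * \prod_(k <- l) (1 + oapp (g k) 0 (x k))) <= _); last first.
    by apply: ler_wpM2l => //; exact: IH.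
  rewrite -totalZ; apply: total_le => x cx.
  rewrite assign_same /= mulrCA ler_wpM2l //.
  have -> : \prod_(k <- l) (1 + oapp (g k) 0 (assign x j u k)) =
            \prod_(k <- l) (1 + oapp (g k) 0 (x k)).
    rewrite !big_seq; apply: eq_bigr => k kl; rewrite assign_other //.
    by apply: contraNneq jl => <-.
  apply: ler_wpM2r => //; apply: wta => //; exact: (chooses_out cx).
rewrite -mulr_suml -mulrA -[X in _ <= X]mulrA.
apply: ler_wpM2l; first exact: sumr_ge0.
rewrite mulrCA; apply: ler_wpM2l; first exact: B0.
by rewrite ler_pdivlMl ?b0 //; exact: wts.
Qed.

End PartialAssignments.

(** * Exponential moments *)

Section ExponentialMoments.

Variables (R : realType) (J U : finType) (X : J -> {set U}) (beta : J -> R).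

Lemma expR_le_quad (y : R) : 0 <= y -> y <= 1/2 ->
  expR y - 1 <= y * (1 + 2 * y).
Proof.
move=> y0 y1.
have h : (1 - y) * expR y <= 1.
  have := expR_ge1Dx (- y); rewrite expRN => h.
  apply: le_trans (_ : (expR y)^-1 * expR y <= _).
    by apply: ler_wpM2r => //; exact: expR_ge0.
  by rewrite mulVf // gt_eqF // expR_gt0.
have : (1 - y) * expR y <= (1 - y) * (1 + y * (1 + 2 * y)) by nra.
rewrite ler_pM2l; lra.
Qed.

(** Exponentials of sums are products of functions of single variables, so
[total_prod_le] applies; [mu] is an upper bound for the mean, and [Gam] bounds
the influence of one variable. *)
Lemma total_expR_le (S : {set J}) (wt : {ffun J -> option U} -> R)
    (w : J -> U -> R) (lam Gam mu : R) :
  (forall x, 0 <= wt x) -> antitone X wt -> spread X beta S wt ->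
  (forall j, j \in S -> 0 < beta j) ->
  0 <= Gam -> (forall j u, 0 <= w j u <= Gam) -> 0 <= lam -> lam * Gam <= 1/2 ->
  \sum_(j in S) (\sum_(u in X j) w j u) / beta j <= mu ->
  total X S (fun x => wt x * expR (lam * picked_sum w x)) <=
  expR (lam * (1 + 2 * (lam * Gam)) * mu) * total X S wt.
Proof.
move=> wt0 wta wts b0 Gam0 w0 l0 lG hmu.
set g : J -> U -> R := fun j u => expR (lam * w j u) - 1.
have g0 j u : 0 <= g j u.
  rewrite /g subr_ge0 -[leLHS]expR0 ler_expR mulr_ge0 //.
  by case/andP: (w0 j u).
have E x : expR (lam * picked_sum w x) =
    \prod_(j <- index_enum J) (1 + oapp (g j) 0 (x j)).
  rewrite /picked_sum mulr_sumr expR_sum; apply: eq_bigr => j _.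
  by case: (x j) => [u|] /=; rewrite ?mulr0 ?expR0 ?addr0 // /g addrC subrK.
under eq_total => x _ do rewrite E.
apply: le_trans (total_prod_le (index_enum_uniq J) wt0 wta wts b0 g0 (subxx _)) _.
apply: ler_wpM2r; first exact: total_ge0.
apply: le_trans (_ : \prod_(j in S) expR ((\sum_(u in X j) g j u) / beta j) <= _).
  apply: ler_prod => j jS; rewrite expR_ge1Dx andbT.
  by rewrite addr_ge0 // divr_ge0 ?sumr_ge0 // ltW // b0.
rewrite -expR_sum ler_expR.
apply: le_trans (ler_wpM2l (_ : 0 <= lam * (1 + 2 * (lam * Gam))) hmu);
  last by rewrite mulr_ge0 // addr_ge0 // !mulr_ge0.
rewrite mulr_sumr; apply: ler_sum => j jS; rewrite [leRHS]mulrA.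
apply: ler_wpM2r; first by rewrite invr_ge0 ltW // b0.
rewrite mulr_sumr; apply: ler_sum => u _.
have /andP[w1 w2] := w0 j u.
have lw : lam * w j u <= lam * Gam by exact: ler_wpM2l.
apply: le_trans (expR_le_quad _ _) _; first exact: mulr_ge0.
  exact: le_trans lw lG.
rewrite [leRHS]mulrAC; apply: ler_wpM2l; first exact: mulr_ge0.
by rewrite lerD2l ler_wpM2l.
Qed.

End ExponentialMoments.

(** * Soft counting *)

Definition ramp (R : realType) (y : R) : R := Num.min 1 (Num.max 0 (2 - y)).

Section Ramp.

Variable R : realType.
Implicit Types y z : R.

Lemma ramp_ge0 y : 0 <= ramp y.
Proof. by rewrite /ramp le_min ler01 le_max lexx. Qed.

Lemma ramp_le1 y : ramp y <= 1.
Proof. by rewrite /ramp ge_min lexx. Qed.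

Lemma ramp1 y : y <= 1 -> ramp y = 1.
Proof.
by move=> y1; rewrite /ramp min_l // le_max; apply/orP; right; lra.
Qed.

Lemma ramp_gt0 y : 0 < ramp y -> y < 2.
Proof.
rewrite /ramp lt_min lt_max ltxx /= => /andP[_]; lra.
Qed.

Lemma ramp_antitone y z : y <= z -> ramp z <= ramp y.
Proof.
by move=> yz; rewrite /ramp le_min2 // le_max2 //; lra.
Qed.

Lemma ramp_lipschitz y z : y <= z -> ramp y - ramp z <= z - y.
Proof.
move=> yz; rewrite /ramp.
case: (lerP 0 (2 - y)) => h1; case: (lerP 0 (2 - z)) => h2.
- by case: (lerP 1 (2 - y)) => h3; case: (lerP 1 (2 - z)) => h4; lra.
- by case: (lerP 1 (2 - y)) => h3; case: (lerP 1 (0 : R)) => h4; lra.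
- by case: (lerP 1 (0 : R)) => h3; case: (lerP 1 (2 - z)) => h4; lra.
- by rewrite subrr subr_ge0.
Qed.

(** Changing the factors [a i] into [b i] one by one costs at most
[a i - b i] times the product of the other factors, all of which are at most
their old values. *)
Lemma prod_ge_telescope (I : eqType) (l : seq I) (a b : I -> R) : uniq l ->
  (forall i, 0 <= b i <= a i) -> (forall i, a i <= 1) ->
  \prod_(i <- l) a i -
    \sum_(i <- l) (a i - b i) * \prod_(k <- l | k != i) a k
  <= \prod_(i <- l) b i.
Proof.
move=> ul ba a1.
have a0 i : 0 <= a i by case/andP: (ba i) => /le_trans; apply.
elim: l ul => [_|i l IH /= /andP[il ul]]; first by rewrite !big_nil subr0.
have {}IH := IH ul; rewrite !big_cons eqxx /=.
have -> : \prod_(k <- l | k != i) a k = \prod_(k <- l) a k.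
  rewrite big_seq_cond [RHS]big_seq; apply: eq_bigl => k.
  by case kl: (k \in l) => //=; apply: contraNneq il => <-.
have -> : \sum_(k <- l) (a k - b k) * \prod_(k0 <- i :: l | k0 != k) a k0 =
    a i * \sum_(k <- l) (a k - b k) * \prod_(k0 <- l | k0 != k) a k0.
  rewrite mulr_sumr !big_seq; apply: eq_bigr => k kl.
  have -> : \prod_(k0 <- i :: l | k0 != k) a k0 =
      a i * \prod_(k0 <- l | k0 != k) a k0.
    by rewrite big_cons; case: eqP => // ik; rewrite ik kl in il.
  by rewrite mulrCA.
set A := \prod_(k <- l) a k in IH *.
set Delta := \sum_(k <- l) _ in IH *.
set B := \prod_(k <- l) b k in IH *.
have D0 : 0 <= Delta.
  apply: sumr_ge0 => k _; apply: mulr_ge0; last exact: prodr_ge0.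
  by rewrite subr_ge0; case/andP: (ba k).
case/andP: (ba i) => bi0 bia.
have : b i * (A - Delta) <= b i * B by exact: ler_wpM2l.
have : b i * Delta <= a i * Delta by exact: ler_wpM2r.
rewrite !mulrBl mulrBr; lra.
Qed.

End Ramp.

Section SoftCounting.

Variables (R : realType) (J U C : finType) (X : J -> {set U}) (e : rel U).
Variables (F : C -> {ffun J -> option U} -> R) (w : C -> J -> U -> R).
Variables (S0 : {set J}) (kap zet W q : R).
Implicit Types (x : {ffun J -> option U}) (wt : {ffun J -> option U} -> R).

Definition clear (x : {ffun J -> option U}) : bool :=
  [forall j, forall k, (j != k) ==>
     (if x j is Some u then if x k is Some v then ~~ e u v else true
      else true)].

(** The factor by which a new variable [j] multiplies the total weight; [kap] is
the relative loss that conflicts and thresholds together may cause. *)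
Definition share (j : J) : R := #|X j|%:R / (1 + kap).

(** The set [I] of statistics varies, because bounding the loss that is due to
the statistic [i] uses the weight in which the factor of [i] is omitted. *)
Definition soft (I : {set C}) (x : {ffun J -> option U}) : R :=
  (clear x)%:R * \prod_(i in I) ramp (F i x).

Lemma clearP x : reflect
  (forall j k u v, j != k -> x j = Some u -> x k = Some v -> ~~ e u v)
  (clear x).
Proof.
apply: (iffP forallP) => [H j k u v jk xj xk|H j].
  by move/forallP/(_ k): (H j); rewrite jk xj xk.
apply/forallP=> k; apply/implyP=> jk.
by case xj: (x j) => [u|] //; case xk: (x k) => [v|] //; exact: (H j k).
Qed.

Lemma clear_assign x j u : x j = None -> clear (assign x j u) -> clear x.
Proof.
move=> xj /clearP H; apply/clearP=> i k v v' ik xi xk.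
have ne l y : x l = Some y -> l != j by move=> xl; apply: contraPneq xl => ->; rewrite xj.
by apply: (H i k v v') => //; rewrite assign_other // ?(ne _ _ xi) ?(ne _ _ xk).
Qed.

Hypothesis e_sym : symmetric e.

Lemma unclear_assign x j u : clear x -> ~~ clear (assign x j u) ->
  exists k v, [/\ k != j, x k = Some v & e u v].
Proof.
move=> /clearP cx H.
case: (pickP (fun k => (k != j) && (if x k is Some v then e u v else false))).
  move=> k /andP[kj]; case xk: (x k) => [v|] // uv.
  by exists k, v.
move=> H0; case/negP: H; apply/clearP=> i k v v' ik.
have [ij|ij] := eqVneq i j.
  have [kj|kj] := eqVneq k j; first by rewrite ij kj eqxx in ik.
  rewrite ij assign_same => -[<-].
  rewrite assign_other // => xk.
  by move: (H0 k); rewrite kj xk /= => ->.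
rewrite assign_other // => xi; have [->|kj] := eqVneq k j.
  rewrite assign_same => -[<-]; rewrite e_sym.
  by move: (H0 i); rewrite ij xi /= => ->.
by rewrite assign_other // => xk; apply: (cx i k).
Qed.

Hypothesis X_gt0 : forall j, j \in S0 -> (0 < #|X j|)%N.
Hypothesis kap_ge0 : 0 <= kap.
Hypothesis w_bnd : forall i j u, 0 <= w i j u <= 1/2.
Hypothesis F_step : forall i x j u, x j = None -> u \in X j ->
  F i x <= F i (assign x j u) <= F i x + w i j u.
Hypothesis F_start : forall i, F i [ffun=> None] <= 1.
Hypothesis q_bnd : 0 <= q <= 1/2.
Hypothesis F_tail : forall wt (S : {set J}) i,
  S \subset S0 -> (forall x, 0 <= wt x) -> antitone X wt ->
  spread X share S wt ->
  total X S (fun x => wt x * (1/2 < F i x)%R%:R) <= q * total X S wt.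
Hypothesis w_total : forall j, j \in S0 ->
  \sum_(u in X j) \sum_i w i j u <= W * #|X j|%:R.
Hypothesis e_total : forall j, j \in S0 ->
  \sum_(u in X j) \sum_(k in S0 | k != j) \sum_(v in X k | e u v) (share k)^-1
    <= zet * #|X j|%:R.
Hypothesis budget : (1 + kap)^-1 <= 1 - zet - 2 * W * q.

Lemma share_gt0 j : j \in S0 -> 0 < share j.
Proof.
by move=> jS; rewrite /share divr_gt0 ?ltr0n ?X_gt0 // ltr_wpDr.
Qed.

Lemma soft_ge0 I x : 0 <= soft I x.
Proof. by rewrite mulr_ge0 // prodr_ge0 // => i _; exact: ramp_ge0. Qed.

Lemma soft_antitone I : antitone X (soft I).
Proof.
move=> x j u xj uX; rewrite /soft.
have [cu|_] := boolP (clear (assign x j u)); last first.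
  by rewrite mul0r; exact: soft_ge0.
rewrite (clear_assign xj cu) !mul1r; apply: ler_prod => i _.
rewrite ramp_ge0; apply: ramp_antitone.
by case/andP: (F_step i xj uX).
Qed.

(** Forget the value of [k]: the weight does not decrease, and the total weight
of the assignments without [k] is small by [spread]. *)
Lemma total_pinned_le (A : {set J}) wt k v : A \subset S0 ->
  (forall x, 0 <= wt x) -> antitone X wt -> spread X share A wt ->
  k \in A -> v \in X k ->
  total X A (fun x => wt x * (x k == Some v)%:R) <= (share k)^-1 * total X A wt.
Proof.
move=> AS wt0 wta wts kA vX.
have kAk : k \notin A :\ k by rewrite !inE eqxx.
rewrite -{1}(setD1K kA) total_step // (bigD1 v) //= [X in _ + X]big1 ?addr0.
  rewrite ler_pdivlMl ?share_gt0 //; last exact: (subsetP AS).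
  apply: le_trans (wts _ _ (subxx _) kA); apply: ler_wpM2l.
    by rewrite ltW // share_gt0 //; exact: (subsetP AS).
  apply: total_le => x cx; rewrite assign_same eqxx mulr1.
  by apply: wta => //; exact: (chooses_out cx).
move=> u /andP[_ uv]; rewrite /total big1 // => x _.
by rewrite assign_same (_ : _ == _ = false) ?mulr0 //; apply: contraNF uv => /eqP[->].
Qed.

(** The tail hypothesis speaks of the weight without the factor of [i].
Restoring this factor changes only assignments with [F i] above 1, which make
up at most a fraction [q <= 1/2] of the total weight; hence the factor 2. *)
Lemma total_soft_drop (A : {set J}) (I : {set C}) i : A \subset S0 ->
  spread X share A (soft (I :\ i)) -> i \in I ->
  total X A (fun x => soft (I :\ i) x * (1/2 < F i x)%R%:R) <=
  2 * q * total X A (soft I).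
Proof.
move=> AS sp iI; set wt := soft (I :\ i).
have T := F_tail i AS (soft_ge0 _) (soft_antitone _) sp.
have wt0 : 0 <= total X A wt by apply: total_ge0 => x; exact: soft_ge0.
have : (1 - q) * total X A wt <= total X A (soft I).
  rewrite mulrBl mul1r; apply: le_trans (_ : total X A wt -
    total X A (fun x => wt x * (1/2 < F i x)%R%:R) <= _).
    by rewrite lerD2l lerN2.
  rewrite -totalB; apply: total_le => x _.
  have -> : soft I x = wt x * ramp (F i x).
    by rewrite /soft (big_setD1 _ iI) /= /wt /soft mulrCA mulrC.
  have w0 := soft_ge0 (I :\ i) x; rewrite -/wt in w0.
  case: ltrP => h; rewrite ?mulr1 ?subrr ?mulr0 ?subr0.
    by rewrite mulr_ge0 // ramp_ge0.
  by rewrite ramp1 ?mulr1 //; lra.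
case/andP: q_bnd => q0 q2 H; apply: le_trans T _.
rewrite -/wt mulrAC [leRHS]mulrC ler_wpM2l //.
have : 0 <= (1/2 - q) * total X A wt by rewrite mulr_ge0 // subr_ge0.
rewrite mulrBl; lra.
Qed.

(** The two sums are what the new value [u] can destroy: assignments in which
some [x k] is adjacent to [u], and the decrease of each ramp factor, which
vanishes unless [F i x] is within the increment [w i j u <= 1/2] of 1. *)
Lemma soft_assign_ge (A : {set J}) (I : {set C}) x j u :
  chooses X A x -> j \notin A -> u \in X j ->
  soft I x
   - \sum_(k in A) \sum_(v in X k | e u v) soft I x * (x k == Some v)%:R
   - \sum_(i in I) w i j u * (soft (I :\ i) x * (1/2 < F i x)%R%:R)
  <= soft I (assign x j u).
Proof.
move=> cA jA uX.
have xj : x j = None by exact: (chooses_out cA).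
have s1 : 0 <= \sum_(k in A) \sum_(v in X k | e u v)
    soft I x * (x k == Some v)%:R.
  by apply: sumr_ge0 => k _; apply: sumr_ge0 => v _; rewrite mulr_ge0 ?soft_ge0.
have s2 : 0 <= \sum_(i in I) w i j u * (soft (I :\ i) x * (1/2 < F i x)%R%:R).
  apply: sumr_ge0 => i _; apply: mulr_ge0; first by case/andP: (w_bnd i j u).
  by rewrite mulr_ge0 ?soft_ge0.
have s3 := soft_ge0 I (assign x j u).
have [cx|ncx] := boolP (clear x); last first.
  have : soft I x = 0 by rewrite /soft (negbTE ncx) mul0r.
  lra.
have [cu|ncu] := boolP (clear (assign x j u)); last first.
  have [k [v [kj xk uv]]] := unclear_assign cx ncu.
  have kA : k \in A.
    by apply: contraPT xk => kA; rewrite (chooses_out cA kA).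
  have vX : v \in X k by have [v' ? ] := chooses_in cA kA; rewrite xk => -[->].
  suff : soft I x <= \sum_(k in A) \sum_(v in X k | e u v)
    soft I x * (x k == Some v)%:R by lra.
  rewrite (bigD1 k) //= (bigD1 v) /= ?vX // xk eqxx mulr1 -addrA lerDl.
  rewrite addr_ge0 //; first by apply: sumr_ge0 => v' _; rewrite mulr_ge0 ?soft_ge0.
  by apply: sumr_ge0 => k' _; apply: sumr_ge0 => v' _; rewrite mulr_ge0 ?soft_ge0.
have E (y : {ffun J -> option U}) (I' : {set C}) : clear y -> soft I' y = \prod_(i in I') ramp (F i y).
  by move=> cy; rewrite /soft cy mul1r.
rewrite [in leRHS]E // [X in X - _ - _]E //.
have := @prod_ge_telescope R C (enum I) (fun i => ramp (F i x))
  (fun i => ramp (F i (assign x j u))) (enum_uniq _) _ (fun i => ramp_le1 _).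
rewrite !big_enum /= => H; apply: le_trans (H _); last first.
  move=> i; rewrite ramp_ge0 ramp_antitone //.
  by case/andP: (F_step i xj uX).
rewrite -addrA lerD2l -opprD lerN2.
apply: le_trans (_ : \sum_(i in I) w i j u * (soft (I :\ i) x * (1/2 < F i x)%R%:R) <= _);
  last by rewrite lerDr.
apply: ler_sum => i iI.
rewrite E // -big_filter.
have -> : \prod_(k <- [seq k <- enum I | k != i]) ramp (F k x) =
    \prod_(k in I :\ i) ramp (F k x).
  by rewrite big_filter big_enum_cond /=; apply: eq_bigl => k; rewrite !inE andbC.
have [F1 F2] := andP (F_step i xj uX).
case: (ltrP (1/2) (F i x)) => h.
  rewrite mulr1; apply: ler_wpM2r.
    by apply: prodr_ge0 => k _; exact: ramp_ge0.
  by apply: le_trans (ramp_lipschitz F1) _; rewrite lerBlDl.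
have /andP[_ w2] := w_bnd i j u.
by rewrite !ramp1 ?subrr ?mul0r ?mulr0 //; lra.
Qed.

(** Sum [soft_assign_ge] over all values of [j].  The conflicts cost a fraction
[zet] of the trivial lower bound [#|X j|] times the old total weight, the
statistics a fraction [2 * W * q]. *)
Lemma soft_step (A : {set J}) j : A \subset S0 -> j \in S0 -> j \notin A ->
  (forall I, spread X share A (soft I)) ->
  forall I, share j * total X A (soft I) <= total X (j |: A) (soft I).
Proof.
move=> AS jS jA sp I; rewrite total_step //.
set N := total X A (soft I).
have N0 : 0 <= N by apply: total_ge0 => x; exact: soft_ge0.
case/andP: q_bnd => q0 q2.
apply: le_trans (_ : \sum_(u in X j) (N -
   \sum_(k in S0 | k != j) \sum_(v in X k | e u v) (share k)^-1 * N -
   \sum_i w i j u * (2 * q * N)) <= _); last first.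
  apply: ler_sum => u uX.
  apply: le_trans (total_le (fun x cx => soft_assign_ge I cx jA uX)).
  rewrite !totalB !total_sum -/N lerB //; last first.
    rewrite [leRHS](bigID (mem I)) /= -[leLHS]addr0 lerD //; last first.
      apply: sumr_ge0 => i _; rewrite !mulr_ge0 //.
      by case/andP: (w_bnd i j u).
    apply: ler_sum => i iI; rewrite totalZ ler_wpM2l //.
      by case/andP: (w_bnd i j u).
    exact: total_soft_drop.
  rewrite lerD2l lerN2.
  apply: le_trans (_ : \sum_(k in A) \sum_(v in X k | e u v) (share k)^-1 * N <= _).
    apply: ler_sum => k kA; rewrite total_sum; apply: ler_sum => v /andP[vX _].
    apply: total_pinned_le => //; [exact: soft_ge0|exact: soft_antitone].
  rewrite [leRHS](bigID (mem A)) /= -[leLHS]addr0 lerD //; last first.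
    apply: sumr_ge0 => k /andP[/andP[kS _] _]; apply: sumr_ge0 => v _.
    by rewrite mulr_ge0 // invr_ge0 ltW // share_gt0.
  rewrite le_eqVlt; apply/orP; left; apply/eqP; apply: eq_bigl => k.
  have [kA|] := boolP (k \in A); last by rewrite andbF.
  rewrite (subsetP AS _ kA) andbT /=; symmetry.
  by apply: contraNneq jA => <-.
rewrite !sumrB sumr_const -[N *+ _]mulr_natr.
have -> : \sum_(u in X j) \sum_(k in S0 | k != j) \sum_(v in X k | e u v)
    (share k)^-1 * N =
  (\sum_(u in X j) \sum_(k in S0 | k != j) \sum_(v in X k | e u v)
    (share k)^-1) * N.
  rewrite mulr_suml; apply: eq_bigr => u _; rewrite mulr_suml.
  by apply: eq_bigr => k _; rewrite mulr_suml.
have -> : \sum_(u in X j) \sum_i w i j u * (2 * q * N) =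
  (\sum_(u in X j) \sum_i w i j u) * (2 * q * N).
  by rewrite mulr_suml; apply: eq_bigr => u _; rewrite mulr_suml.
have h1 : (\sum_(u in X j) \sum_(k in S0 | k != j) \sum_(v in X k | e u v)
    (share k)^-1) * N <= zet * #|X j|%:R * N.
  by apply: ler_wpM2r => //; exact: e_total.
have h2 : (\sum_(u in X j) \sum_i w i j u) * (2 * q * N) <=
    W * #|X j|%:R * (2 * q * N).
  by apply: ler_wpM2r; [rewrite !mulr_ge0|exact: w_total].
have h3 : share j * N <= (1 - zet - 2 * W * q) * (#|X j|%:R * N).
  rewrite /share mulrAC mulrC; apply: ler_wpM2r => //; exact: mulr_ge0.
lra.
Qed.

Lemma soft_spread n (A : {set J}) I : A \subset S0 -> (#|A| < n)%N ->
  spread X share A (soft I).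
Proof.
elim: n A I => // n IH A I AS An B j BA jB.
rewrite -{2}(setD1K jB); apply: soft_step => [|||I'].
- apply: subset_trans AS; apply: subset_trans BA; exact: subsetDl.
- by apply: (subsetP AS); apply: (subsetP BA).
- by rewrite !inE eqxx.
apply: IH; first by apply: subset_trans AS; apply: subset_trans BA; exact: subsetDl.
have := subset_leq_card BA; rewrite (cardsD1 j B) jB add1n => /leq_trans; apply.
by rewrite -ltnS.
Qed.

(** The total weight is positive, so some assignment has positive weight; a
positive ramp factor means that the statistic is below 2. *)
Lemma soft_counting : exists x,
  [/\ chooses X S0 x, clear x & forall i, F i x < 2].
Proof.
have pos (A : {set J}) : A \subset S0 -> 0 < total X A (soft setT).
  elim: {A}#|A| {-2}A (erefl #|A|) => [|n IH] A.
    move/cards0_eq => -> _; rewrite total_set0 /soft.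
    have -> : clear [ffun=> None] by apply/clearP=> j k u v _; rewrite ffunE.
    rewrite mul1r big1 // => i _; rewrite ramp1 //; exact: F_start.
  move=> An AS; have /card_gt0P[j jA] : (0 < #|A|)%N by rewrite An.
  have AjS : A :\ j \subset S0 by apply: subset_trans AS; exact: subsetDl.
  have /IH/(_ AjS) h : #|A :\ j| = n by move: An; rewrite (cardsD1 j A) jA => -[].
  have := @soft_spread #|A|.+1 A setT AS (ltnSn _) A j (subxx _) jA.
  by apply: lt_le_trans; rewrite mulr_gt0 // share_gt0 //; exact: (subsetP AS).
have := pos S0 (subxx _).
case: (pickP (fun x => chooses X S0 x && (0 < soft setT x))) => [x /andP[cx]|H].
  move=> h _; exists x; split=> //.
    by apply: contraLR h => /negbTE h; rewrite /soft h mul0r ltxx.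
  move=> i; apply: ramp_gt0; rewrite lt_neqAle ramp_ge0 andbT eq_sym.
  apply: contraTneq h => h; rewrite /soft (bigD1 i) //= h mul0r mulr0 ltxx.
  by [].
rewrite ltNge => /negP[]; apply: sumr_le0 => x cx.
by move: (H x); rewrite cx /= => /negbT; rewrite -leNgt.
Qed.

End SoftCounting.

(** * Splitting the parts into classes *)

Section Neighbours.

Variables (R : realType) (U J : finType) (e : rel U) (V : J -> {set U}).

Definition deg_to (v : U) (A : {set U}) : R := \sum_(u in A) (e v u)%:R.

Definition deg_all (v : U) : R := \sum_j deg_to v (V j).

Lemma deg_to_ge0 v A : 0 <= deg_to v A.
Proof. by apply: sumr_ge0 => u _; exact: ler0n. Qed.

Lemma deg_all_ge0 v : 0 <= deg_all v.
Proof. by apply: sumr_ge0 => j _; exact: deg_to_ge0. Qed.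

Lemma sum_deg_toC (A B : {set U}) : symmetric e ->
  \sum_(u in A) deg_to u B = \sum_(v in B) deg_to v A.
Proof.
move=> es; rewrite exchange_big /=; apply: eq_bigr => v _.
by apply: eq_bigr => u _; rewrite es.
Qed.

End Neighbours.

Lemma picked_sum_upd (R : realType) (J U : finType) (w : J -> U -> R)
    (x : {ffun J -> option U}) j u : x j = None ->
  picked_sum w (assign x j u) = picked_sum w x + w j u.
Proof.
move=> xj; rewrite /picked_sum (bigD1 j) //= assign_same /= addrC [in RHS](bigD1 j) //=.
rewrite xj /= add0r; congr (_ + _); apply: eq_bigr => k kj.
by rewrite assign_other.
Qed.

Lemma picked_sum_none (R : realType) (J U : finType) (w : J -> U -> R) :
  picked_sum w [ffun=> None] = 0.
Proof. by rewrite /picked_sum big1 // => j _; rewrite ffunE. Qed.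

(** The variables are now the parts, and their values the classes.  The
statistic of a part adds up the amounts by which its vertices exceed their
allowance [Y] of neighbours in a class.  A positive part is used rather than
the number of bad vertices: it is Lipschitz, so that the total increment is
under control, and its mean is bounded through the exponential moment.
Vertices of degree above [D / eta] are left out, as they are few and have no
useful tail bound. *)

Section Splitting.

Variables (R : realType) (U J : finType) (e : rel U) (V : J -> {set U}).
Variables (T N : nat) (D eta gam nu Lam : R).

Hypothesis e_sym : symmetric e.
Hypothesis D_gt0 : 0 < D.
Hypothesis N_gt0 : (0 < N)%N.
Hypothesis T_gt0 : (0 < T)%N.
Hypothesis V_card : forall i, #|V i| = N.
Hypothesis V_local : forall v i, deg_to R e v (V i) <= gam * D.
Hypothesis V_avg : forall i, \sum_(v in V i) deg_all R e V v <= D * N%:R.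
Hypothesis gam_ge0 : 0 <= gam.
Hypothesis eta_bnd : 0 < eta <= 1.
Hypothesis nuE : nu = eta ^+ 2 / (2 * T%:R).
Hypothesis LamE : Lam = 16 * T%:R / (nu ^+ 2 * eta).
Hypothesis gam_nu : gam <= nu / 2.
Hypothesis gam_Lam : gam * (8 * Lam ^+ 2) <= eta.
Hypothesis gam_Lam1 : Lam * gam <= 1/2.

Let Y (v : U) : R := (1 + eta) * deg_all R e V v / T%:R + eta * D / T%:R.
Let om (v : U) (s : 'I_T) (j : J) (c : 'I_T) : R :=
  (c == s)%:R * deg_to R e v (V j).
Let V0 (i : J) : {set U} := [set v in V i | deg_all R e V v <= D / eta].
Let scale : R := nu * N%:R * D.
Let F (i : J) (x : {ffun J -> option 'I_T}) : R :=
  (\sum_(v in V0 i) \sum_s Num.max 0 (picked_sum (om v s) x - Y v)) / scale.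

Lemma max0_le_expR (lam y : R) : 0 < lam ->
  Num.max 0 y <= expR (lam * y) / lam.
Proof.
move=> l0; rewrite ge_max divr_ge0 ?expR_ge0 ?(ltW l0) //=.
rewrite ler_pdivlMr // mulrC; apply: le_trans (expR_ge1Dx _).
by rewrite lerDr.
Qed.


Let X (j : J) : {set 'I_T} := [set: 'I_T].

Lemma sum_om v j c : \sum_s om v s j c = deg_to R e v (V j).
Proof.
rewrite (bigD1 c) //= /om eqxx mul1r big1 ?addr0 // => s sc.
by rewrite eq_sym (negbTE sc) mul0r.
Qed.

Lemma om_ge0 v s j c : 0 <= om v s j c.
Proof. by rewrite mulr_ge0 ?deg_to_ge0 ?ler0n. Qed.

(** The allowance [Y v] exceeds the mean by [eta * D / T]; taking
[lam = Lam / D] in [max0_le_expR], the smallness of [gam] keeps the exponent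
below 1/2, and the factor [Lam^-1] comes from [1 / lam]. *)
Lemma total_excess_le (S : {set J}) (wt : {ffun J -> option 'I_T} -> R) v s :
  (forall x, 0 <= wt x) -> antitone X wt -> spread X (share X eta) S wt ->
  deg_all R e V v <= D / eta ->
  total X S (fun x => wt x * Num.max 0 (picked_sum (om v s) x - Y v)) <=
  2 * D / Lam * total X S wt.
Proof.
move=> wt0 wta wts dv.
have /andP[eta0 eta1] := eta_bnd.
have T0 : 0 < T%:R :> R by rewrite ltr0n.
have nu0 : 0 < nu by rewrite nuE divr_gt0 ?exprn_gt0 ?mulr_gt0.
have Lam0 : 0 < Lam by rewrite LamE divr_gt0 ?mulr_gt0 ?exprn_gt0.
pose lam := Lam / D; have lam0 : 0 < lam by rewrite divr_gt0.
pose mu := (1 + eta) * deg_all R e V v / T%:R.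
have mu0 : 0 <= mu by rewrite !mulr_ge0 ?deg_all_ge0 ?invr_ge0 // addr_ge0 ?ltW.
have H := @total_expR_le R J _ X (share X eta) S wt (om v s) lam (gam * D) mu
   wt0 wta wts.
have shE j : share X eta j = T%:R / (1 + eta).
  by rewrite /share /X cardsT card_ord.
have lgE : lam * (gam * D) = Lam * gam.
  by rewrite /lam; field; rewrite gt_eqF.
have {}H : total X S (fun x => wt x * expR (lam * picked_sum (om v s) x)) <=
    expR (lam * (1 + 2 * (Lam * gam)) * mu) * total X S wt.
  rewrite -lgE; apply: H => //.
  - by move=> j _; rewrite shE divr_gt0 // ltr_wpDr // ltW.
  - by rewrite mulr_ge0 // ltW.
  - move=> j c; rewrite om_ge0 /=; apply: le_trans (V_local v j).
    by rewrite /om ler_piMl ?deg_to_ge0 // lern1 leq_b1.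
  - exact: ltW.
  - by rewrite lgE.
  apply: le_trans (_ : \sum_(j in S) deg_to R e v (V j) * ((1 + eta) / T%:R) <= _).
    apply: ler_sum => j _; rewrite shE invf_div; apply: ler_wpM2r.
      by rewrite divr_ge0 // addr_ge0 // ltW.
    under eq_bigl => c do rewrite inE.
    rewrite (bigD1 s) //= /om eqxx mul1r big1 ?addr0 // => c cs.
    by rewrite (negbTE cs) mul0r.
  rewrite -mulr_suml /mu mulrAC mulrC; apply: ler_wpM2l.
    by rewrite divr_ge0 // addr_ge0 // ltW.
  rewrite /deg_all [leRHS](bigID (mem S)) /= lerDl.
  by apply: sumr_ge0 => j _; exact: deg_to_ge0.
apply: le_trans (_ : total X S (fun x => (expR (- (lam * Y v)) / lam) *
    (wt x * expR (lam * picked_sum (om v s) x))) <= _).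
  apply: total_le => x _; rewrite mulrCA; apply: ler_wpM2l => //.
  apply: le_trans (max0_le_expR _ lam0) _.
  rewrite mulrBr addrC expRD le_eqVlt; apply/orP; left; apply/eqP.
  by field; rewrite gt_eqF.
rewrite totalZ; apply: le_trans (ler_wpM2l _ H) _.
  by rewrite divr_ge0 ?expR_ge0 ?ltW.
rewrite [leLHS]mulrA; apply: ler_wpM2r; first exact: total_ge0.
rewrite [leLHS]mulrAC -expRD.
have -> : 2 * D / Lam = 2 / lam by rewrite /lam; field; rewrite !gt_eqF.
apply: ler_wpM2r; first by rewrite invr_ge0 ltW.
have -> : - (lam * Y v) + lam * (1 + 2 * (Lam * gam)) * mu =
    2 * (Lam ^+ 2 * gam) * ((1 + eta) / T%:R) * (deg_all R e V v / D) - Lam * eta / T%:R.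
  by rewrite /Y /mu /lam; field; rewrite !gt_eqF.
have e2 : expR (1/2) <= 2 :> R.
  have := @expR_le_quad R (1/2) _ _; lra.
apply: le_trans e2; rewrite ler_expR.
have b1 : (1 + eta) / T%:R <= 2.
  rewrite ler_pdivrMr //; have : 1 <= T%:R :> R by rewrite ler1n.
  nra.
have b2 : deg_all R e V v / D <= eta^-1 by rewrite ler_pdivrMr // mulrC.
have b3 : 0 <= Lam * eta / T%:R by rewrite divr_ge0 ?mulr_ge0 ?ltW.
have b4 : ((1 + eta) / T%:R) * (deg_all R e V v / D) <= 2 * eta^-1.
  apply: ler_pM => //; first by rewrite divr_ge0 ?addr_ge0 ?ltW.
  by rewrite divr_ge0 ?deg_all_ge0 ?ltW.
have b5 : 2 * (Lam ^+ 2 * gam) * (((1 + eta) / T%:R) * (deg_all R e V v / D)) <=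
    2 * (Lam ^+ 2 * gam) * (2 * eta^-1).
  by rewrite ler_wpM2l // mulr_ge0 // mulr_ge0 // exprn_ge0 // ltW.
have b6 : 2 * (Lam ^+ 2 * gam) * (2 * eta^-1) <= 1/2.
  have -> : 2 * (Lam ^+ 2 * gam) * (2 * eta^-1) = gam * (8 * Lam ^+ 2) / 2 / eta.
    by field; rewrite gt_eqF.
  by rewrite ler_pdivrMr //; move: gam_Lam; lra.
rewrite -[X in X - _]mulrA; lra.
Qed.

(** There are no conflicts here.  Before the division by [scale], choosing the
class of the part [j] increases all statistics together by at most the number
of edges at [V j], which is at most [D * N]; this is comparable with [scale]
because all parts have the same size. *)
Lemma splitting_count : exists x : {ffun J -> option 'I_T},
  chooses X [set: J] x /\ forall i, F i x < 2.
Proof.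
have /andP[eta0 eta1] := eta_bnd.
have T0 : 0 < T%:R :> R by rewrite ltr0n.
have N0 : 0 < N%:R :> R by rewrite ltr0n.
have nu0 : 0 < nu by rewrite nuE divr_gt0 ?exprn_gt0 ?mulr_gt0.
have Lam0 : 0 < Lam by rewrite LamE divr_gt0 ?mulr_gt0 ?exprn_gt0.
have sc0 : 0 < scale by rewrite /scale !mulr_gt0.
have V0V i : V0 i \subset V i by apply/subsetP=> v; rewrite inE => /andP[].
have cardV i : (#|V i|%:R : R) = N%:R by rewrite V_card.
have cardV0 i : (#|V0 i|%:R : R) <= N%:R.
  by rewrite ler_nat -(V_card i) subset_leq_card.
pose w (i : J) (j : J) (c : 'I_T) : R :=
  (\sum_(v in V0 i) deg_to R e v (V j)) / scale.
pose q := 4 * T%:R / (nu * Lam).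
have qE : q = nu * eta / 4.
  by rewrite /q LamE; field; rewrite !gt_eqF.
have nu1 : nu <= 1.
  rewrite nuE ler_pdivrMr ?mulr_gt0 //.
  have : 1 <= T%:R :> R by rewrite ler1n.
  have : eta ^+ 2 <= 1 by rewrite exprn_ile1 // ltW.
  lra.
have q_bnd : 0 <= q <= 1/2.
  rewrite qE; apply/andP; split; first by rewrite divr_ge0 ?mulr_ge0 ?ltW.
  have : nu * eta <= 1 * 1 by apply: ler_pM => //; exact: ltW.
  lra.
have w0 i j c : 0 <= w i j c.
  by rewrite divr_ge0 ?(ltW sc0) // sumr_ge0 // => v _; exact: deg_to_ge0.
have F0 i x : 0 <= F i x.
  rewrite divr_ge0 ?(ltW sc0) // sumr_ge0 // => v _.
  by apply: sumr_ge0 => s _; rewrite le_max lexx.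
have w_bnd i j c : 0 <= w i j c <= 1/2.
  rewrite w0 ler_pdivrMr //.
  apply: le_trans (_ : \sum_(v in V0 i) gam * D <= _).
    by apply: ler_sum => v _; exact: V_local.
  rewrite sumr_const -[leLHS]mulr_natl.
  apply: le_trans (_ : N%:R * (nu / 2 * D) <= _).
    apply: ler_pM => //; first by rewrite mulr_ge0 // ltW.
    by apply: ler_wpM2r => //; exact: ltW.
  by rewrite /scale; lra.
have F_step i (x : {ffun J -> option 'I_T}) j c : x j = None -> c \in X j ->
    F i x <= F i (assign x j c) <= F i x + w i j c.
  move=> xj _; rewrite /F /w -mulrDl !ler_pM2r ?invr_gt0 // -big_split /=.
  have E v s : picked_sum (om v s) (assign x j c) = picked_sum (om v s) x + om v s j c.
    exact: picked_sum_upd.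
  apply/andP; split; apply: ler_sum => v _.
    apply: ler_sum => s _; rewrite E le_max2 // lerD2r lerDl; exact: om_ge0.
  rewrite -(sum_om v j c) -big_split /=; apply: ler_sum => s _.
  rewrite E; have := om_ge0 v s j c.
  set a := picked_sum _ x; set d := om v s j c => d0.
  rewrite ge_max; apply/andP; split.
    by rewrite addr_ge0 // le_max lexx.
  by rewrite addrAC lerD2r le_max lexx orbT.
have F_start i : F i [ffun=> None] <= 1.
  rewrite /F big1 ?mul0r // => v _; rewrite big1 // => s _.
  rewrite picked_sum_none sub0r max_l // oppr_le0 /Y addr_ge0 //.
    by rewrite divr_ge0 ?mulr_ge0 ?deg_all_ge0 ?addr_ge0 ?ltW.
  by rewrite divr_ge0 ?mulr_ge0 ?ltW.
have F_tail (wt : {ffun J -> option 'I_T} -> R) (S : {set J}) i :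
  S \subset setT -> (forall x, 0 <= wt x) -> antitone X wt ->
  spread X (share X eta) S wt ->
  total X S (fun x => wt x * (1/2 < F i x)%R%:R) <= q * total X S wt.
  move=> _ wt0 wta wts.
  apply: le_trans (_ : total X S (fun x => 2 / scale *
    \sum_(v in V0 i) \sum_s wt x * Num.max 0 (picked_sum (om v s) x - Y v)) <= _).
    apply: total_le => x _.
    have -> : 2 / scale * (\sum_(v in V0 i) \sum_s wt x *
        Num.max 0 (picked_sum (om v s) x - Y v)) = wt x * (2 * F i x).
      rewrite /F; under eq_bigr => v _ do rewrite -mulr_sumr.
      by rewrite -mulr_sumr; field; rewrite gt_eqF.
    apply: ler_wpM2l => //; have := F0 i x.
    by case: ltrP => /= h; lra.
  rewrite totalZ total_sum.
  apply: le_trans (_ : 2 / scale * (\sum_(v in V0 i) \sum_(s < T)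
     2 * D / Lam * total X S wt) <= _).
    apply: ler_wpM2l; first by rewrite divr_ge0 ?(ltW sc0).
    apply: ler_sum => v; rewrite inE => /andP[_ dv].
    by rewrite total_sum; apply: ler_sum => s _; exact: total_excess_le.
  under eq_bigr => v _ do rewrite sumr_const card_ord -[_ *+ T]mulr_natl.
  rewrite sumr_const -[X in _ / _ * X]mulr_natl !mulrA.
  apply: ler_wpM2r; first exact: total_ge0.
  have -> : 2 / scale * #|V0 i|%:R * T%:R * 2 * D / Lam =
      q * (#|V0 i|%:R / N%:R).
    by rewrite /q /scale; field; rewrite !gt_eqF.
  by rewrite ler_piMr ?(andP q_bnd).1 // ler_pdivrMr // mul1r.
have X_gt0 j : j \in [set: J] -> (0 < #|X j|)%N by rewrite /X cardsT card_ord.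
have w_total j : j \in [set: J] ->
    \sum_(c in X j) \sum_i w i j c <= nu^-1 * #|X j|%:R.
  move=> _; rewrite /w sumr_const -[leLHS]mulr_natr; apply: ler_wpM2r => //.
  rewrite -mulr_suml ler_pdivrMr // /scale -mulrA mulKf ?gt_eqF //.
  apply: le_trans (_ : \sum_i \sum_(v in V i) deg_to R e v (V j) <= _).
    apply: ler_sum => i _; rewrite [leRHS](bigID (mem (V0 i))) /=.
    rewrite -[leLHS]addr0 lerD //; last by apply: sumr_ge0 => v _; exact: deg_to_ge0.
    rewrite le_eqVlt; apply/orP; left; apply/eqP; apply: eq_bigl => v.
    by rewrite inE; case: (v \in V i).
  under eq_bigr => i _ do rewrite sum_deg_toC //.
  by rewrite exchange_big /= mulrC; exact: V_avg.
have e_total j : j \in [set: J] -> \sum_(c in X j)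
    \sum_(k in [set: J] | k != j) \sum_(v in X k | false) (share X eta k)^-1
    <= 0 * #|X j|%:R.
  move=> _; rewrite mul0r big1 // => c _; rewrite big1 // => k _.
  by rewrite big_pred0 // => v; rewrite andbF.
have budget : (1 + eta)^-1 <= 1 - 0 - 2 * nu^-1 * q.
  have -> : 2 * nu^-1 * q = eta / 2 by rewrite qE; field; rewrite gt_eqF.
  rewrite -[leLHS]div1r ler_pdivrMr ?addr_gt0 //; nra.
have [x [cx _ Fx]] := @soft_counting R J 'I_T J X (fun _ _ => false) F w setT
  eta 0 nu^-1 q (fun _ _ => erefl) X_gt0 (ltW eta0) w_bnd F_step F_start q_bnd
  F_tail w_total e_total budget.
by exists x.
Qed.

(** By Markov's inequality few vertices of [V0 i] exceed their allowance by
[eta * D / T] in some class; they are deleted, and so are the vertices of large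
degree. *)
Lemma splitting : exists (c : J -> 'I_T) (V1 : J -> {set U}), forall i,
  [/\ V1 i \subset V i, (1 - 2 * eta) * N%:R <= #|V1 i|%:R &
    forall v, v \in V1 i -> deg_all R e V v <= D / eta /\
      forall s : 'I_T, \sum_(j | c j == s) deg_to R e v (V j) <=
        (1 + eta) * deg_all R e V v / T%:R + 2 * (eta * D / T%:R)].
Proof.
have [x [cx Fx]] := splitting_count.
have /andP[eta0 eta1] := eta_bnd.
have T0 : 0 < T%:R :> R by rewrite ltr0n.
have N0 : 0 < N%:R :> R by rewrite ltr0n.
have nu0 : 0 < nu by rewrite nuE divr_gt0 ?exprn_gt0 ?mulr_gt0.
have sc0 : 0 < scale by rewrite /scale !mulr_gt0.
pose c j := odflt (Ordinal T_gt0) (x j).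
have xc j : x j = Some (c j).
  by have [a _ xj] := chooses_in cx (in_setT j); rewrite /c xj.
have bE v s : picked_sum (om v s) x = \sum_(j | c j == s) deg_to R e v (V j).
  rewrite /picked_sum [RHS]big_mkcond; apply: eq_bigr => j _; rewrite xc /= /om.
  by case: eqP; rewrite ?mul1r ?mul0r.
pose good v := [forall s, picked_sum (om v s) x <= Y v + eta * D / T%:R].
exists c, (fun i => [set v in V0 i | good v]) => i; split.
- by apply/subsetP=> v; rewrite !inE => /andP[/andP[]].
- have V0V : V0 i \subset V i by apply/subsetP=> v; rewrite inE => /andP[].
  have h1 : (#|V i :\: V0 i|%:R : R) <= eta * N%:R.
    have : \sum_(v in V i :\: V0 i) D / eta <= D * N%:R.
      apply: le_trans (V_avg i); rewrite [leRHS](big_setID (V0 i)) /=.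
      rewrite -[leLHS]add0r lerD //; first by apply: sumr_ge0 => v _; exact: deg_all_ge0.
      apply: ler_sum => v; rewrite !inE => /andP[+ vV]; rewrite vV /= -ltNge.
      exact: ltW.
    rewrite sumr_const -[X in X <= _]mulr_natl => h.
    rewrite -(ler_pM2r (divr_gt0 D_gt0 eta0)); apply: le_trans h _.
    by rewrite le_eqVlt; apply/orP; left; apply/eqP; field; rewrite gt_eqF.
  have h2 : (#|V0 i :\: [set v in V0 i | good v]|%:R : R) <= eta * N%:R.
    have exc0 v : 0 <= \sum_s Num.max 0 (picked_sum (om v s) x - Y v).
      by apply: sumr_ge0 => s _; rewrite le_max lexx.
    have : \sum_(v in V0 i :\: [set v in V0 i | good v]) eta * D / T%:R
        <= 2 * scale.
      apply: le_trans (_ : \sum_(v in V0 i) \sum_s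
        Num.max 0 (picked_sum (om v s) x - Y v) <= _); last first.
        by have := Fx i; rewrite /F ltr_pdivrMr // => /ltW.
      rewrite [leRHS](big_setID [set v in V0 i | good v]) /=.
      rewrite -[leLHS]add0r lerD //; first exact: sumr_ge0.
      apply: ler_sum => v; rewrite in_setD in_set => /andP[+ vV].
      rewrite vV /= => /forallPn[s]; rewrite -ltNge => hs.
      rewrite (bigD1 s) //= -[leLHS]addr0 lerD //.
        by rewrite le_max; apply/orP; right; lra.
      by apply: sumr_ge0 => s' _; rewrite le_max lexx.
    rewrite sumr_const -[X in X <= _]mulr_natl => h.
    have p0 : 0 < eta * D / T%:R by rewrite divr_gt0 ?mulr_gt0.
    rewrite -(ler_pM2r p0); apply: le_trans h _.
    by rewrite le_eqVlt /scale nuE; apply/orP; left; apply/eqP; field; rewrite gt_eqF.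
  have e1 := cardsID (V0 i) (V i); rewrite (setIidPr V0V) V_card in e1.
  have e2 := cardsID [set v in V0 i | good v] (V0 i).
  have sub : [set v in V0 i | good v] \subset V0 i.
    by apply/subsetP=> v; rewrite !inE => /andP[].
  rewrite (setIidPr sub) in e2.
  move/(congr1 (fun k => k%:R : R)): e1; move/(congr1 (fun k => k%:R : R)): e2.
  rewrite !natrD; lra.
- move=> v; rewrite !inE => /andP[/andP[vV dv] /forallP gv]; split=> // s.
  by have := gv s; rewrite bE /Y; lra.
Qed.

End Splitting.

(** * One round of picks *)

Section Round.

Variables (R : realType) (J U : finType) (X : J -> {set U}) (e : rel U).
Variables (S0 : {set J}) (om : J -> U -> R) (mu : J -> R).
Variables (n r Gam M Delta B eta lam : R).

(** [om i u] is the damage that the pick [u] does to the part [i], [mu i] a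
bound for the expected damage, [M] for all [mu i], and [Delta] for the total
damage done by one pick.  [B] bounds the degrees inside the class and [n] the
number of vertices left in a part.  The damage is rescaled so that exceeding
the mean by [r] corresponds to the point where the ramp begins to fall. *)
Lemma round_picks : symmetric e ->
  0 < n -> (forall j, j \in S0 -> n <= #|X j|%:R) ->
  (forall i u, 0 <= om i u <= Gam) ->
  (forall i, \sum_(j in S0) (\sum_(u in X j) om i u) / share X eta j <= mu i) ->
  (forall i, 0 <= mu i <= M) ->
  (forall j u, j \in S0 -> u \in X j -> \sum_i om i u <= Delta) ->
  (forall j u, j \in S0 -> u \in X j ->
     \sum_(k in S0) deg_to R e u (X k) <= B) ->
  0 < eta <= 1 -> 0 < r -> 0 < lam -> 0 <= Gam -> 0 <= Delta ->
  2 * Gam <= r -> lam * Gam <= 1/2 -> 8 * (lam * Gam) * M <= r ->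
  8 <= lam * r -> (1 + eta) * B / n <= eta / 4 ->
  32 * Delta <= eta * (lam * r ^+ 2) ->
  exists x, [/\ chooses X S0 x, clear e x &
    forall i, picked_sum (fun _ => om i) x <= mu i + 2 * r].
Proof.
move=> es n0 Xn om0 hmu muM hDelta hB /andP[eta0 eta1] r0 lam0 Gam0 Delta0 Gr lG.
move=> lGM lr hBn hD.
pose F (i : J) (x : {ffun J -> option U}) := (picked_sum (fun _ => om i) x - mu i) / r.
pose w (i j : J) (u : U) := om i u / r.
pose q := 4 / (lam * r).
have lr0 : 0 < lam * r by rewrite mulr_gt0.
have q_bnd : 0 <= q <= 1/2.
  by rewrite /q divr_ge0 ?(ltW lr0) //= ler_pdivrMr //; lra.
have X_gt0 j : j \in S0 -> (0 < #|X j|)%N.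
  by move=> /Xn h; rewrite -(ltr0n R); exact: lt_le_trans h.
have w_bnd i j u : 0 <= w i j u <= 1/2.
  have /andP[o1 o2] := om0 i u.
  by rewrite divr_ge0 ?(ltW r0) //= ler_pdivrMr //; lra.
have F_step i (x : {ffun J -> option U}) j u : x j = None -> u \in X j ->
    F i x <= F i (assign x j u) <= F i x + w i j u.
  move=> xj _; rewrite /F /w picked_sum_upd // -mulrDl !ler_pM2r ?invr_gt0 //.
  by have /andP[o1 o2] := om0 i u; apply/andP; split; lra.
have F_start i : F i [ffun=> None] <= 1.
  rewrite /F picked_sum_none sub0r ler_pdivrMr // mul1r.
  by have /andP[] := muM i; lra.
have F_tail (wt : {ffun J -> option U} -> R) (S : {set J}) i :
  S \subset S0 -> (forall x, 0 <= wt x) -> antitone X wt ->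
  spread X (share X eta) S wt ->
  total X S (fun x => wt x * (1/2 < F i x)%R%:R) <= q * total X S wt.
  move=> SS wt0 wta wts.
  have H := @total_expR_le R J _ X (share X eta) S wt (fun _ => om i) lam Gam (mu i)
    wt0 wta wts.
  have {}H : total X S (fun x => wt x * expR (lam * picked_sum (fun _ => om i) x)) <=
    expR (lam * (1 + 2 * (lam * Gam)) * mu i) * total X S wt.
    apply: H => //.
    - move=> j jS; apply: (@share_gt0 R J U X S0) => //; last exact: (subsetP SS).
      exact: ltW.
    - exact: ltW.
    - apply: le_trans (hmu i); rewrite [leRHS](bigID (mem S)) /=.
      rewrite -[leLHS]addr0 lerD //.
        rewrite le_eqVlt; apply/orP; left; apply/eqP; apply: eq_bigl => j.
        by case jS: (j \in S); rewrite ?andbF // (subsetP SS).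
      apply: sumr_ge0 => j /andP[jS _]; rewrite divr_ge0 //.
        by apply: sumr_ge0 => u _; case/andP: (om0 i u).
      by rewrite ltW // (@share_gt0 R J U X S0) // ltW.
  apply: le_trans (_ : total X S (fun x => expR (- (lam * (mu i + r / 2))) *
    (wt x * expR (lam * picked_sum (fun _ => om i) x))) <= _).
    apply: total_le => x _; rewrite mulrCA; apply: ler_wpM2l => //.
    rewrite -expRD; case: ltrP => /= h; last exact: expR_ge0.
    apply: le_trans (expR_ge1Dx _); rewrite lerDl addrC subr_ge0.
    apply: ler_wpM2l; first exact: ltW.
    by move: h; rewrite /F ltr_pdivlMr //; lra.
  rewrite totalZ; apply: le_trans (ler_wpM2l (expR_ge0 _) H) _.
  rewrite [leLHS]mulrA -expRD; apply: ler_wpM2r; first exact: total_ge0.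
  set y := _ + _ : R.
  have hy : y <= - (lam * r / 4).
    have /andP[m0 mM] := muM i.
    have : 8 * (lam * Gam) * mu i <= r.
      by apply: le_trans lGM; apply: ler_wpM2l; rewrite // !mulr_ge0 // ltW.
    move/(ler_wpM2l (ltW lam0)); rewrite /y; lra.
  apply: le_trans (_ : expR (- (lam * r / 4)) <= _); first by rewrite ler_expR.
  rewrite expRN -[leLHS]mul1r ler_pdivrMr ?expR_gt0 //.
  apply: le_trans (_ : q * (1 + lam * r / 4) <= _); last first.
    by apply: ler_wpM2l; [case/andP: q_bnd|exact: expR_ge1Dx].
  have -> : q * (1 + lam * r / 4) = q + 1.
    by rewrite /q; field; rewrite !gt_eqF.
  by rewrite lerDr; case/andP: q_bnd.
have w_total j : j \in S0 ->
    \sum_(u in X j) \sum_i w i j u <= Delta / r * #|X j|%:R.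
  move=> jS; apply: le_trans (_ : \sum_(u in X j) Delta / r <= _).
    apply: ler_sum => u uX; rewrite /w -mulr_suml ler_pM2r ?invr_gt0 //.
    exact: (hDelta j).
  by rewrite sumr_const mulr_natr.
have e_total j : j \in S0 -> \sum_(u in X j) \sum_(k in S0 | k != j)
    \sum_(v in X k | e u v) (share X eta k)^-1 <= eta / 4 * #|X j|%:R.
  move=> jS; apply: le_trans (_ : \sum_(u in X j) eta / 4 <= _); last first.
    by rewrite sumr_const mulr_natr.
  apply: ler_sum => u uX; apply: le_trans hBn.
  apply: le_trans (_ : \sum_(k in S0) deg_to R e u (X k) * ((1 + eta) / n) <= _);
    last first.
    rewrite -mulr_suml mulrC mulrAC; apply: ler_wpM2r.
      by rewrite invr_ge0 ltW.
    by apply: ler_wpM2l; [rewrite addr_ge0 // ltW|exact: (hB j)].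
  rewrite [leRHS](bigID (fun k => k != j)) /= -[leLHS]addr0 lerD //; last first.
    apply: sumr_ge0 => k _; rewrite mulr_ge0 ?deg_to_ge0 // divr_ge0 ?addr_ge0 ?ltW //.
  apply: ler_sum => k /andP[kS _]; rewrite /deg_to big_mkcondr /= mulr_suml.
  apply: ler_sum => v _; case: (e u v); last by rewrite mul0r.
  rewrite mul1r /share invf_div; apply: ler_wpM2l; first by rewrite addr_ge0 // ltW.
  rewrite lef_pV2 ?posrE //; first exact: Xn.
  by rewrite ltr0n X_gt0.
have budget : (1 + eta)^-1 <= 1 - eta / 4 - 2 * (Delta / r) * q.
  have : 2 * (Delta / r) * q <= eta / 4.
    have -> : 2 * (Delta / r) * q = 32 * Delta / (lam * r ^+ 2) / 4.
      by rewrite /q; field; rewrite !gt_eqF.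
    rewrite ler_pM2r ?invr_gt0 // ler_pdivrMr // mulr_gt0 // exprn_gt0 //.
  move=> h; rewrite -[leLHS]div1r ler_pdivrMr ?addr_gt0 //; nra.
have [x [cx clx Fx]] := @soft_counting R J U J X e F w S0
  eta (eta / 4) (Delta / r) q es X_gt0 (ltW eta0) w_bnd F_step F_start q_bnd
  F_tail w_total e_total budget.
exists x; split=> // i; have := Fx i.
by rewrite /F ltr_pdivrMr //; lra.
Qed.

End Round.

(** * Survival probabilities *)

Section Potential.

Variables (R : realType) (n : nat -> R) (M : R).
Hypothesis n_gt0 : forall k, 0 < n k.
Hypothesis n_ge : forall k, M <= n k.

Lemma survival_bnd (x : R) s t : 0 <= x <= M ->
  0 <= \prod_(s <= k < t) (1 - x / n k) <= 1.
Proof.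
move=> /andP[x0 xM].
have fac k : 0 <= 1 - x / n k <= 1.
  by rewrite subr_ge0 lerBlDr lerDl divr_ge0 ?(ltW (n_gt0 k)) // andbT
     ler_pdivrMr // mul1r (le_trans xM).
rewrite prodr_ge0 /=; last by move=> k _; case/andP: (fac k).
by apply: prodr_ile1 => k _; exact: fac.
Qed.

(** Convexity of the product in the form of a tangent line at [a].  It passes to
one more factor since all slopes are nonpositive: the second order term
[- sl * (x - a) ^+ 2 / n t] has the right sign. *)
Lemma survival_tangent (a : R) s t : 0 <= a <= M ->
  exists2 sl : R, sl <= 0 & forall x, 0 <= x <= M ->
    \prod_(s <= k < t) (1 - a / n k) + sl * (x - a) <=
    \prod_(s <= k < t) (1 - x / n k).
Proof.
move=> aM; elim: t => [|t [sl sl0 IH]].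
  by exists 0 => // x _; rewrite !big_geq // mul0r addr0.
have [ts|st] := ltnP t s.
  by exists 0 => // x _; rewrite !big_geq // mul0r addr0.
set P := \prod_(s <= k < t) (1 - a / n k) in IH *.
have /andP[P0 _] := survival_bnd s t aM.
exists ((1 - a / n t) * sl - P / n t).
  rewrite subr_le0; apply: (@le_trans _ _ 0).
    rewrite mulr_ge0_le0 // subr_ge0 ler_pdivrMr // mul1r.
    by apply: le_trans (n_ge t); case/andP: aM.
  by rewrite divr_ge0 // ltW.
move=> x xM; rewrite !big_nat_recr //= -/P.
apply: le_trans (ler_wpM2r _ (IH x xM)); last first.
  rewrite subr_ge0 ler_pdivrMr // mul1r.
  by apply: le_trans (n_ge t); case/andP: xM.
have -> : (P + sl * (x - a)) * (1 - x / n t) =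
    P * (1 - a / n t) + ((1 - a / n t) * sl - P / n t) * (x - a)
    - sl * (x - a) ^+ 2 / n t.
  by field; rewrite gt_eqF.
rewrite lerDl oppr_ge0 mulr_le0_ge0 ?invr_ge0 ?(ltW (n_gt0 t)) //.
by rewrite mulr_le0_ge0 // sqr_ge0.
Qed.

Lemma survival_jensen (I : finType) (A : {set I}) (x : I -> R) (a : R) s t :
  0 <= a <= M -> (forall i, i \in A -> 0 <= x i <= M) ->
  \sum_(i in A) x i <= a * #|A|%:R ->
  #|A|%:R * \prod_(s <= k < t) (1 - a / n k) <=
  \sum_(i in A) \prod_(s <= k < t) (1 - x i / n k).
Proof.
move=> aM xM xa; have [sl sl0 H] := survival_tangent s t aM.
apply: le_trans (_ : \sum_(i in A) (\prod_(s <= k < t) (1 - a / n k) +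
    sl * (x i - a)) <= _); last first.
  by apply: ler_sum => i iA; apply: H; exact: xM.
rewrite big_split /= sumr_const -[X in X + _]mulr_natl lerDl -mulr_sumr.
rewrite mulr_le0 // sumrB sumr_const -[a *+ _]mulr_natr subr_le0 //.
Qed.

(** If all degrees were equal, the predicted sizes would be attained. *)
Lemma survival_telescope (h : R) t :
  (forall k, (k < t)%N -> n k.+1 = n k - h) ->
  \prod_(0 <= k < t) (1 - h / n k) = n t / n 0%N.
Proof.
elim: t => [|t IH] nS; first by rewrite big_geq // divff // gt_eqF.
rewrite big_nat_recr //= IH ?nS //; last by move=> k kt; rewrite nS // ltnW.
field.
by rewrite !gt_eqF.
Qed.

End Potential.

(** * All rounds together *)

Section Rounds.

Variables (R : realType) (J U : finType) (e : rel U) (V V1 : J -> {set U}).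
Variables (T N : nat) (c : J -> 'I_T) (n : nat -> R) (cw : U -> R).
Variables (nlow M r Gam Delta B eta lam : R).

Hypothesis e_sym : symmetric e.
Hypothesis V1_sub : forall i, V1 i \subset V i.
Hypothesis V_card : forall i, #|V i| = N.
Hypothesis V_local : forall v i, deg_to R e v (V i) <= Gam.
Hypothesis nlow_gt0 : 0 < nlow.
Hypothesis n_ge : forall k, nlow <= n k.
Hypothesis M_le : M <= nlow.
Hypothesis cw_bnd : forall i v, v \in V1 i -> 0 <= cw v <= M.
Hypothesis class_cw : forall i v (s : 'I_T), v \in V1 i ->
  (1 + eta) * \sum_(j | c j == s) deg_to R e v (V j) <= cw v.
Hypothesis class_B : forall i v (s : 'I_T), v \in V1 i ->
  \sum_(j | c j == s) deg_to R e v (V j) <= B.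
Hypothesis deg_all_Delta : forall i v, v \in V1 i -> deg_all R e V v <= Delta.
Hypothesis eta_bnd : 0 < eta <= 1.
Hypothesis r_gt0 : 0 < r.
Hypothesis lam_gt0 : 0 < lam.
Hypothesis Gam_ge0 : 0 <= Gam.
Hypothesis Delta_ge0 : 0 <= Delta.
Hypothesis Gam_r : 2 * Gam <= r.
Hypothesis lam_Gam : lam * Gam <= 1/2.
Hypothesis lam_Gam_r : 8 * (lam * Gam) * N%:R <= r.
Hypothesis lam_r : 8 <= lam * r.
Hypothesis B_small : (1 + eta) * B / nlow <= eta / 4.
Hypothesis Delta_small : 32 * Delta <= eta * (lam * r ^+ 2).

Definition left_over (x : {ffun J -> option U}) (i : J) : {set U} :=
  [set v in V1 i | [forall j, if x j is Some u then ~~ e v u else true]].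

Let phi (i : J) (s : nat) (v : U) : R := \prod_(s <= k < c i) (1 - cw v / n k).

Definition done_by (s : nat) : {set J} := [set j | (c j < s)%N].

(** The parts of the first [s] classes have their picks.  For any other part,
the sum of the survival probabilities until its own round is at least the
planned size [n (c i)], plus an allowance [2 * r] for the deviation in each
round still to come. *)
Definition on_track (s : nat) (x : {ffun J -> option U}) : Prop :=
  [/\ chooses V1 (done_by s) x, clear e x &
    forall i, (s <= c i)%N ->
      n (c i) + (T - s)%:R * (2 * r) <= \sum_(v in left_over x i) phi i s v].

(** In the round [s] the vertex [v] is deleted with probability at most
[cw v / n s], and [phi i s v = (1 - cw v / n s) * phi i s.+1 v]; hence the
potential does not decrease in the mean, and [round_picks] bounds the
deviation by [2 * r]. *)
Lemma on_track_step s x : (s < T)%N -> on_track s x ->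
  exists z, on_track s.+1 z.
Proof.
move=> sT [cx clx tx].
have /andP[eta0 eta1] := eta_bnd.
have n_gt0 k : 0 < n k by exact: lt_le_trans (n_ge k).
have nM k : M <= n k by exact: le_trans (n_ge k).
pose S0 := [set j | c j == Ordinal sT].
have S0P j : j \in S0 -> c j = s :> nat by rewrite inE => /eqP ->.
pose X := left_over x.
have XV1 i : X i \subset V1 i by apply/subsetP=> v; rewrite inE => /andP[].
have phi_bnd i t v : v \in V1 i -> 0 <= phi i t v <= 1.
  by move=> vV; apply: (survival_bnd n_gt0 nM); exact: (cw_bnd vV).
pose om (i : J) (u : U) := \sum_(v in X i) (e u v)%:R * phi i s.+1 v.
pose mu (i : J) := \sum_(v in X i) phi i s.+1 v * (cw v / n s).
have XS j : j \in S0 -> n s <= #|X j|%:R.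
  move=> jS; have sj := S0P _ jS.
  have := tx j; rewrite sj leqnn => /(_ isT) h.
  have : n s <= \sum_(v in X j) phi j s v.
    apply: le_trans h; rewrite lerDl mulr_ge0 // mulr_ge0 // ltW //.
  move=> /le_trans; apply.
  rewrite -sum1_card natr_sum; apply: ler_sum => v vX.
  by have /andP[] := phi_bnd j s v (subsetP (XV1 j) _ vX).
have om_bnd i u : 0 <= om i u <= Gam.
  have vp v : v \in X i -> 0 <= phi i s.+1 v <= 1.
    by move=> vX; apply: phi_bnd; exact: (subsetP (XV1 i)).
  apply/andP; split.
    by apply: sumr_ge0 => v /vp/andP[p0 _]; rewrite mulr_ge0.
  apply: le_trans (V_local u i).
  apply: le_trans (_ : deg_to R e u (X i) <= _).
    by apply: ler_sum => v /vp/andP[_ p1]; rewrite ler_piMr.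
  rewrite /deg_to [leRHS](big_setID (X i)) /= (setIidPr _); last first.
    exact: subset_trans (XV1 i) (V1_sub i).
  by rewrite lerDl sumr_ge0.
have nbX v k : deg_to R e v (X k) <= deg_to R e v (V k).
  rewrite /deg_to [leRHS](big_setID (X k)) /= (setIidPr _).
    by rewrite lerDl sumr_ge0.
  exact: subset_trans (XV1 k) (V1_sub k).
have classS0 (f : J -> R) :
    \sum_(j in S0) f j = \sum_(j | c j == Ordinal sT) f j.
  by apply: eq_bigl => j; rewrite inE.
have share_ge j : j \in S0 -> (share X eta j)^-1 <= (1 + eta) / n s.
  move=> jS; rewrite /share invf_div; apply: ler_wpM2l.
    by rewrite addr_ge0 // ltW.
  rewrite lef_pV2 ?posrE //; first exact: XS.
  exact: lt_le_trans (XS j jS).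
have hmu i : \sum_(j in S0) (\sum_(u in X j) om i u) / share X eta j <= mu i.
  apply: le_trans (_ : \sum_(j in S0) \sum_(v in X i)
      phi i s.+1 v * (deg_to R e v (V j) * ((1 + eta) / n s)) <= _).
    apply: ler_sum => j jS; rewrite mulr_suml /om.
    under eq_bigr => u _ do rewrite mulr_suml.
    rewrite exchange_big /=; apply: ler_sum => v vX.
    have /andP[p0 _] := phi_bnd i s.+1 v (subsetP (XV1 i) _ vX).
    apply: le_trans (_ : phi i s.+1 v * (deg_to R e v (X j) / share X eta j) <= _).
      rewrite /deg_to mulr_suml mulr_sumr; apply: ler_sum => u _.
      by rewrite e_sym mulrAC mulrC.
    apply: ler_wpM2l => //; apply: ler_pM; rewrite ?deg_to_ge0 ?share_ge //.
    by rewrite invr_ge0 divr_ge0 // addr_ge0 // ltW.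
  rewrite exchange_big /=; apply: ler_sum => v vX.
  have vV := subsetP (XV1 i) _ vX.
  have /andP[p0 _] := phi_bnd i s.+1 v vV.
  rewrite -mulr_sumr; apply: ler_wpM2l => //.
  rewrite -mulr_suml classS0 mulrA; apply: ler_wpM2r.
    by rewrite invr_ge0 ltW.
  by rewrite mulrC; exact: (class_cw _ vV).
have muM i : 0 <= mu i <= N%:R.
  have tv v : v \in X i -> 0 <= phi i s.+1 v * (cw v / n s) <= 1.
    move=> vX; have vV := subsetP (XV1 i) _ vX.
    have /andP[p0 p1] := phi_bnd i s.+1 v vV.
    have /andP[c0 c1] := cw_bnd vV.
    have d0 : 0 <= cw v / n s by rewrite divr_ge0 // ltW.
    rewrite mulr_ge0 //= mulr_ile1 // ler_pdivrMr // mul1r.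
    exact: le_trans (nM s).
  apply/andP; split; first by apply: sumr_ge0 => v /tv/andP[].
  apply: le_trans (_ : \sum_(v in X i) 1 <= _).
    by apply: ler_sum => v /tv/andP[].
  rewrite sumr_const ler_nat -(V_card i) subset_leq_card //.
  exact: subset_trans (XV1 i) (V1_sub i).
have hDelta j u : j \in S0 -> u \in X j -> \sum_i om i u <= Delta.
  move=> _ uX; have uV := subsetP (XV1 j) _ uX.
  apply: le_trans (deg_all_Delta uV); apply: ler_sum => i _.
  apply: le_trans (nbX u i); apply: ler_sum => v vX.
  have /andP[_ p1] := phi_bnd i s.+1 v (subsetP (XV1 i) _ vX).
  by rewrite ler_piMr.
have hB j u : j \in S0 -> u \in X j -> \sum_(k in S0) deg_to R e u (X k) <= B.
  move=> _ uX; apply: le_trans (class_B (Ordinal sT) (subsetP (XV1 j) _ uX)).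
  by rewrite classS0; apply: ler_sum => k _.
have nX j : j \in S0 -> nlow <= #|X j|%:R.
  by move=> jS; apply: le_trans (XS j jS).
have [y [cy cly hy]] := @round_picks R J U X e S0 om mu nlow r Gam N%:R
  Delta B eta lam e_sym nlow_gt0 nX om_bnd hmu muM hDelta hB eta_bnd r_gt0
  lam_gt0 Gam_ge0 Delta_ge0 Gam_r lam_Gam lam_Gam_r lam_r B_small Delta_small.
pose z : {ffun J -> option U} := [ffun j => if j \in S0 then y j else x j].
have zS j : j \in S0 -> z j = y j by rewrite ffunE => ->.
have zN j : j \notin S0 -> z j = x j by rewrite ffunE => /negbTE ->.
have yX j u : z j = Some u -> j \in S0 -> u \in X j.
  move=> + jS; rewrite zS //.
  by have [u' ? ->] := chooses_in cy jS; move=> -[<-].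
exists z; split.
- apply/forallP=> j; rewrite inE ltnS leq_eqVlt.
  have [jS|jS] := boolP (j \in S0).
    rewrite (S0P j jS) eqxx /= zS //; have [u uX ->] := chooses_in cy jS.
    exact: (subsetP (XV1 j)).
  have -> : (c j == s :> nat) = false.
    by apply: contraNF jS => /eqP cj; rewrite inE; apply/eqP/val_inj.
  by rewrite zN //=; have := forallP cx j; rewrite inE.
- have clearX j k u v : j \notin S0 -> k \in S0 -> z j = Some u ->
      z k = Some v -> ~~ e v u.
    move=> jS kS zj zk; have := yX k v zk kS; rewrite inE => /andP[_].
    by move=> /forallP/(_ j); rewrite -(zN j jS) zj.
  apply/clearP=> j k u v jk zj zk.
  have [jS|jS] := boolP (j \in S0); have [kS|kS] := boolP (k \in S0).
  + by rewrite zS // in zj; rewrite zS // in zk; exact: (clearP _ _ cly j k).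
  + exact: (clearX k j v u).
  + by rewrite e_sym; exact: (clearX j k u v).
  + by rewrite zN // in zj; rewrite zN // in zk; exact: (clearP _ _ clx j k).
move=> i si.
have zX : left_over z i \subset X i.
  apply/subsetP=> v; rewrite !inE => /andP[-> /forallP H] /=.
  apply/forallP=> j; have [jS|jS] := boolP (j \in S0); last first.
    by rewrite -(zN j jS); exact: H.
  rewrite (chooses_out cx) //; rewrite inE -leqNgt; by rewrite (S0P j jS).
have hit : \sum_(v in X i :\: left_over z i) phi i s.+1 v <= picked_sum (fun=> om i) y.
  have -> : picked_sum (fun=> om i) y =
      \sum_(v in X i) \sum_j oapp (fun u => (e u v)%:R * phi i s.+1 v) 0 (y j).
    rewrite exchange_big /=; apply: eq_bigr => j _.
    by case: (y j) => [u|] //=; rewrite big1.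
  have t0 v j : v \in X i -> 0 <= oapp (fun u => (e u v)%:R * phi i s.+1 v) 0 (y j).
    move=> vX; case: (y j) => [u|] //=; rewrite mulr_ge0 //.
    by have /andP[] := phi_bnd i s.+1 v (subsetP (XV1 i) _ vX).
  rewrite [leRHS](big_setID (left_over z i)) /= -[leLHS]add0r lerD //.
    by apply: sumr_ge0 => v; rewrite inE => /andP[vX _]; apply: sumr_ge0 => j _; exact: t0.
  apply: ler_sum => v; rewrite in_setD => /andP[vz vX].
  move: vz; rewrite inE (subsetP (XV1 i) _ vX) /= => /forallPn[j].
  have [jS|jS] := boolP (j \in S0).
    rewrite zS //; case yj: (y j) => [u|] //; rewrite negbK => uv.
    rewrite (bigD1 j) //= yj /= e_sym uv mul1r lerDl.
    by apply: sumr_ge0 => k _; exact: t0.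
  rewrite zN // => /negP[]; move: vX; rewrite inE => /andP[_ /forallP]; exact.
have key : \sum_(v in X i) phi i s v = \sum_(v in X i) phi i s.+1 v - mu i.
  rewrite /mu -sumrB; apply: eq_bigr => v _; rewrite /phi big_ltn //.
  by rewrite mulrBl mul1r mulrC.
have spl : \sum_(v in X i) phi i s.+1 v =
    \sum_(v in left_over z i) phi i s.+1 v +
    \sum_(v in X i :\: left_over z i) phi i s.+1 v.
  by rewrite (big_setID (left_over z i)) /= (setIidPr zX).
have := tx i (ltnW si); rewrite -/(X i) key spl.
have -> : (T - s)%N = (T - s.+1).+1 by rewrite -subSn.
rewrite -natr1; have := hy i; lra.
Qed.

Hypothesis start : forall i,
  n (c i) + T%:R * (2 * r) <= \sum_(v in V1 i) phi i 0 v.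

Lemma rounds : exists x, chooses V1 [set: J] x /\ clear e x.
Proof.
have H s : (s <= T)%N -> exists x, on_track s x.
  elim: s => [_|s IH sT].
    exists [ffun=> None]; split.
    - by apply/forallP=> j; rewrite inE ffunE.
    - by apply/clearP=> j k u v _; rewrite ffunE.
    move=> i _; rewrite subn0 (_ : left_over _ i = V1 i) //; apply/setP=> v.
    by rewrite inE andb_idr // => _; apply/forallP=> j; rewrite ffunE.
  have [x tx] := IH (ltnW sT); exact: on_track_step tx.
have [x [cx clx _]] := H T (leqnn T); exists x; split=> //.
by rewrite (_ : [set: J] = done_by T) //; apply/setP=> j; rewrite !inE ltn_ord.
Qed.

End Rounds.

(** * Independent transversals, with a choice of the constants *)

(** The constants are chosen in the order [eta], [T], [nu], [Lam1] (for the
splitting), [Lam2] (for the rounds), [gam].  After [k] rounds the parts have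
size about [n k], which decreases by [h], about [D / T], per round and stays
above [nlow = eps / 2 * D]. *)
Lemma core (R : realType) (eps : R) : 0 < eps <= 1 ->
  exists2 gam : R, 0 < gam &
  forall (D : R) (J U : finType) (e : rel U) (V : J -> {set U}) (N : nat),
    0 < D -> symmetric e -> (forall i, #|V i| = N) ->
    (1 + eps) * D <= N%:R <= 4 * D ->
    (forall v i, deg_to R e v (V i) <= gam * D) ->
    (forall i, \sum_(v in V i) deg_all R e V v <= D * N%:R) ->
    exists x, chooses V [set: J] x /\ clear e x.
Proof.
move=> /andP[eps0 eps1].
have [eta [epsE eta0 eta1]] : exists eta : R,
    [/\ eps = 40 * eta, 0 < eta & eta <= 1/40].
  by exists (eps / 40); split; lra.
have [T T0 TE] : exists2 T : nat, (0 < T)%N & 48 / (eta ^+ 2 * eps) <= T%:R.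
  have p0 : 0 < 48 / (eta ^+ 2 * eps) by rewrite divr_gt0 // mulr_gt0 ?exprn_gt0.
  have h := archi_boundP (ltW p0).
  by exists (Num.bound (48 / (eta ^+ 2 * eps))); [rewrite -(ltr0n R) (lt_trans p0)|exact: ltW].
have tT : 0 < T%:R :> R by rewrite ltr0n.
have TE' : 48 <= eta ^+ 2 * eps * T%:R.
  rewrite [leRHS]mulrC -ler_pdivrMr //.
  by rewrite mulr_gt0 ?exprn_gt0.
have [nu nuE nu0] : exists2 nu : R, nu = eta ^+ 2 / (2 * T%:R) & 0 < nu.
  by eexists; [reflexivity|rewrite divr_gt0 ?exprn_gt0 ?mulr_gt0].
have [Lam1 Lam1E Lam10] : exists2 Lam1 : R,
    Lam1 = 16 * T%:R / (nu ^+ 2 * eta) & 0 < Lam1.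
  by eexists; [reflexivity|rewrite divr_gt0 ?mulr_gt0 ?exprn_gt0].
have [Lam2 Lam2E Lam20] : exists2 Lam2 : R,
    Lam2 = 512 * T%:R ^+ 2 / (eta ^+ 4 * eps ^+ 2) & 0 < Lam2.
  by eexists; [reflexivity|rewrite divr_gt0 ?mulr_gt0 ?exprn_gt0].
(* The first three bounds serve the splitting, the other three the rounds. *)
have [gam gam0 [g1 g2 g3 [g4 g5 g6]]] : exists2 gam : R, 0 < gam &
  [/\ gam <= nu / 2, gam <= eta / (8 * Lam1 ^+ 2), gam <= (2 * Lam1)^-1 &
   [/\ gam <= eta * eps / (128 * T%:R * Lam2), gam <= (2 * Lam2)^-1 &
       gam <= eta * eps / (8 * T%:R)]].
  exists (Num.min (nu / 2) (Num.min (eta / (8 * Lam1 ^+ 2)) (Num.min (2 * Lam1)^-1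
    (Num.min (eta * eps / (128 * T%:R * Lam2)) (Num.min (2 * Lam2)^-1
      (eta * eps / (8 * T%:R))))))).
    by rewrite !lt_min !divr_gt0 ?invr_gt0 ?mulr_gt0 ?exprn_gt0.
  by split; [..|split]; rewrite !ge_min lexx ?orbT.
exists gam => // D J U e V N D0 es VN /andP[N1 N2] Vloc Vavg.
have N0 : (0 < N)%N.
  by rewrite -(ltr0n R); apply: lt_le_trans N1; rewrite mulr_gt0 // addr_gt0.
have eta_bnd : 0 < eta <= 1 by rewrite eta0 /=; clear - eta1; lra.
have g2' : gam * (8 * Lam1 ^+ 2) <= eta.
  by rewrite -ler_pdivlMr // mulr_gt0 ?exprn_gt0.
have g3' : Lam1 * gam <= 1/2.
  rewrite mulrC -ler_pdivlMr // (_ : 1/2/Lam1 = (2 * Lam1)^-1) //.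
  by field; rewrite gt_eqF.
have [c [V1 HV]] := @splitting R U J e V T N D eta gam nu Lam1 es D0 N0 T0 VN
  Vloc Vavg (ltW gam0) eta_bnd nuE Lam1E g1 g2' g3'.
have [d dE d0] : exists2 d : R, d = D / T%:R & 0 < d.
  by eexists; [reflexivity|rewrite divr_gt0].
have Td : T%:R * d = D by rewrite dE mulrC divfK // gt_eqF.
pose h := (1 + eta) * (1 + 3 * eta) / (1 - 2 * eta) * d.
have p12 : 0 < 1 - 2 * eta by clear - eta1; lra.
have p13 : 0 < 1 - 3 * eta by clear - eta1; lra.
have hrate : (1 + eta) * (1 + 3 * eta) / (1 - 2 * eta) <= 1 + 8 * eta.
  by rewrite ler_pdivrMr //; clear - eta0 eta1; nra.
have h0 : 0 <= h.
  rewrite mulr_ge0 ?(ltW d0) // divr_ge0 ?(ltW p12) //.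
  by rewrite mulr_ge0 // addr_ge0 // ?mulr_ge0 // ltW.
have hd : h <= (1 + 8 * eta) * d by rewrite ler_pM2r.
(* Freezing the sequence after [T] steps keeps it positive, so that the
   survival probabilities are bounded for every index. *)
pose n (k : nat) := (1 - 3 * eta) * N%:R - (minn k T)%:R * h.
pose nlow := eps / 2 * D.
have nlow0 : 0 < nlow by rewrite /nlow mulr_gt0 // divr_gt0.
have n_ge k : nlow <= n k.
  have a1 : (minn k T)%:R * h <= (1 + 8 * eta) * D.
    apply: le_trans (_ : T%:R * h <= _).
      by apply: ler_wpM2r => //; rewrite ler_nat geq_minr.
    by rewrite -Td [leRHS]mulrCA ler_wpM2l.
  have a2 : (1 - 3 * eta) * ((1 + eps) * D) <= (1 - 3 * eta) * N%:R.
    by rewrite ler_pM2l.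
  have a3 : nlow <= (1 - 3 * eta) * ((1 + eps) * D) - (1 + 8 * eta) * D.
    have -> : (1 - 3 * eta) * ((1 + eps) * D) - (1 + 8 * eta) * D =
      ((1 - 3 * eta) * (1 + eps) - (1 + 8 * eta)) * D by ring.
    by rewrite ler_pM2r // epsE; clear - eta0 eta1; nra.
  by rewrite /n; clear - a1 a2 a3; lra.
pose b (v : U) := (1 + eta) * deg_all R e V v / T%:R + 2 * (eta * D / T%:R).
pose cw (v : U) := (1 + eta) * b v.
have b_ge0 v : 0 <= b v.
  rewrite /b addr_ge0 //.
    by rewrite divr_ge0 ?(ltW tT) // mulr_ge0 ?deg_all_ge0 // addr_ge0 // ltW.
  by rewrite mulr_ge0 // divr_ge0 ?(ltW tT) // mulr_ge0 // ltW.
have b_le v : deg_all R e V v <= D / eta -> b v <= 3 * (d / eta).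
  move=> dv; have : b v <= (1 + eta) * (d / eta) + 2 * (eta * d).
    rewrite /b -[eta * D / _]mulrA -dE lerD2r -mulrA ler_pM2l ?addr_gt0 //.
    by rewrite ler_pdivrMr // mulrAC [d * _]mulrC Td.
  move/le_trans; apply.
  have -> : eta * d = eta ^+ 2 * (d / eta) by field; rewrite gt_eqF.
  have -> : (1 + eta) * (d / eta) + 2 * (eta ^+ 2 * (d / eta)) =
    (1 + eta + 2 * eta ^+ 2) * (d / eta) by ring.
  by rewrite ler_pM2r ?divr_gt0 //; clear - eta0 eta1; nra.
pose M := 6 * (d / eta).
have M_le : M <= nlow.
  rewrite /M /nlow -Td.
  have -> : eps / 2 * (T%:R * d) = (eta ^+ 2 * eps * T%:R) / (2 * eta) * (d / eta).
    by field; rewrite gt_eqF.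
  rewrite ler_pM2r ?divr_gt0 // ler_pdivlMr ?mulr_gt0 //.
  by clear - TE' eta1; lra.
have cw_bnd i v : v \in V1 i -> 0 <= cw v <= M.
  move=> vV; have [_ _ /(_ v vV)[dv _]] := HV i.
  rewrite /cw mulr_ge0 ?b_ge0 ?addr_ge0 ?(ltW eta0) //=.
  have := b_le v dv; have := b_ge0 v; rewrite /cw /M => q0 q1.
  apply: le_trans (_ : 2 * b v <= _); last by clear - q1; lra.
  by apply: ler_wpM2r => //; clear - eta1; lra.
have r0 : 0 < eta * eps * d / 4 by rewrite divr_gt0 ?mulr_gt0.
have lam0 : 0 < Lam2 / D by rewrite divr_gt0.
pose r := eta * eps * d / 4.
have r_le : 2 * (gam * D) <= r.
  have -> : r = 2 * (eta * eps / (8 * T%:R) * D).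
    by rewrite /r dE; field; rewrite gt_eqF.
  by rewrite ler_pM2l // ler_pM2r.
have lamGE : Lam2 / D * (gam * D) = Lam2 * gam by field; rewrite gt_eqF.
have lam_Gam : Lam2 / D * (gam * D) <= 1/2.
  rewrite lamGE mulrC -ler_pdivlMr // (_ : 1/2/Lam2 = (2 * Lam2)^-1) //.
  by field; rewrite gt_eqF.
have lam_Gam_r : 8 * (Lam2 / D * (gam * D)) * N%:R <= r.
  rewrite lamGE; apply: le_trans (_ : 8 * (Lam2 * gam) * (4 * D) <= _).
    by rewrite ler_wpM2l // !mulr_ge0 // ltW.
  have -> : r = 8 * (Lam2 * (eta * eps / (128 * T%:R * Lam2))) * (4 * D).
    by rewrite /r dE; field; rewrite !gt_eqF.
  by rewrite ler_pM2r ?mulr_gt0 // ler_pM2l // ler_pM2l.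
have lam_r : 8 <= Lam2 / D * r.
  have -> : Lam2 / D * r = 128 * T%:R / (eta ^+ 3 * eps).
    by rewrite /r Lam2E dE; field; rewrite !gt_eqF.
  rewrite ler_pdivlMr ?mulr_gt0 ?exprn_gt0 //.
  have t1 : 1 <= T%:R :> R by rewrite ler1n.
  have t2 : eta ^+ 3 * eps <= 1 * 1.
    have /andP[_ eta_le1] := eta_bnd.
    apply: ler_pM => //; [exact: exprn_ge0 (ltW eta0)|exact: ltW|].
    by rewrite exprn_ile1 // ltW.
  by clear - t1 t2; lra.
have B_small : (1 + eta) * (3 * (d / eta)) / nlow <= eta / 4.
  rewrite ler_pdivrMr // /nlow -Td.
  have -> : eta / 4 * (eps / 2 * (T%:R * d)) =
     (eta ^+ 2 * eps * T%:R) / 8 * (d / eta) by field; rewrite gt_eqF.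
  by rewrite mulrA ler_pM2r ?divr_gt0 //; clear - TE' eta1; lra.
have Delta_small : 32 * (D / eta) <= eta * (Lam2 / D * r ^+ 2).
  have -> : eta * (Lam2 / D * r ^+ 2) = 32 * (D / eta).
    by rewrite /r Lam2E dE; field; rewrite !gt_eqF.
  by [].
have cls i v (s : 'I_T) : v \in V1 i ->
    \sum_(j | c j == s) deg_to R e v (V j) <= b v.
  by move=> vV; have [_ _ /(_ v vV)[_ ]] := HV i; apply.
have V1V i : V1 i \subset V i by have [] := HV i.
have class_cw i v (s : 'I_T) : v \in V1 i ->
    (1 + eta) * \sum_(j | c j == s) deg_to R e v (V j) <= cw v.
  by move=> vV; rewrite /cw ler_wpM2l ?addr_ge0 ?(ltW eta0) //; exact: cls vV.
have degV1 i v : v \in V1 i -> deg_all R e V v <= D / eta.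
  by move=> vV; have [_ _ /(_ v vV)[]] := HV i.
have class_B i v (s : 'I_T) : v \in V1 i ->
    \sum_(j | c j == s) deg_to R e v (V j) <= 3 * (d / eta).
  by move=> vV; apply: le_trans (cls i v s vV) _; apply: b_le; exact: degV1 vV.
have n_gt0 k : 0 < n k by exact: lt_le_trans (n_ge k).
have start i : n (c i) + T%:R * (2 * r) <=
    \sum_(v in V1 i) \prod_(0 <= k < c i) (1 - cw v / n k).
  have [_ cardV1 _] := HV i.
  have hM : 0 <= h <= M.
    rewrite h0 /=; apply: le_trans hd _; rewrite /M.
    have -> : 6 * (d / eta) = 6 / eta * d by field; rewrite gt_eqF.
    by rewrite ler_pM2r // ler_pdivlMr //; clear - eta0 eta1; nra.
  have avg : \sum_(v in V1 i) cw v <= h * #|V1 i|%:R.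
    apply: le_trans (_ : (1 + eta) * (\sum_(v in V i) b v) <= _).
      rewrite -mulr_sumr ler_wpM2l ?addr_ge0 ?(ltW eta0) //.
      rewrite [leRHS](big_setID (V1 i)) /= (setIidPr (V1V i)) lerDl.
      by apply: sumr_ge0 => v _.
    have sT : (\sum_(v in V i) deg_all R e V v) / T%:R <= d * N%:R.
      by rewrite ler_pdivrMr // mulrAC [d * _]mulrC Td; exact: Vavg.
    have -> : \sum_(v in V i) b v =
        (1 + eta) * ((\sum_(v in V i) deg_all R e V v) / T%:R) + 2 * eta * (d * N%:R).
      rewrite /b big_split /= sumr_const VN -mulr_suml -mulr_sumr dE.
      by rewrite -[_ *+ N]mulr_natr; field; rewrite gt_eqF.
    apply: le_trans (_ : (1 + eta) * ((1 + 3 * eta) * (d * N%:R)) <= _).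
      rewrite ler_wpM2l ?addr_ge0 ?(ltW eta0) //.
      have -> : (1 + 3 * eta) * (d * N%:R) =
        (1 + eta) * (d * N%:R) + 2 * eta * (d * N%:R) by ring.
      by rewrite lerD2r ler_wpM2l ?addr_ge0 ?(ltW eta0).
    apply: le_trans (ler_wpM2l h0 cardV1); rewrite /h le_eqVlt; apply/orP; left.
    by apply/eqP; field; rewrite gt_eqF.
  have nM k : M <= n k by exact: le_trans (n_ge k).
  apply: le_trans (survival_jensen n_gt0 nM 0 (c i) hM (@cw_bnd i) avg).
  rewrite survival_telescope //; last first.
    move=> k kc; have kT : (k < T)%N by exact: ltn_trans (ltn_ord (c i)).
    rewrite /n (minn_idPl kT) (minn_idPl (ltnW kT)) -natr1; ring.
  have n0E : n 0%N = (1 - 3 * eta) * N%:R by rewrite /n min0n mul0r subr0.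
  have -> : T%:R * (2 * r) = eta * nlow.
    by rewrite /r /nlow -Td; field.
  apply: le_trans (_ : (1 + eta) * n (c i) <= _).
    by rewrite mulrDl mul1r lerD2l ler_wpM2l ?(ltW eta0).
  rewrite mulrCA [leLHS]mulrC; apply: ler_wpM2l; first exact: ltW.
  rewrite ler_pdivlMr //; apply: le_trans cardV1; rewrite n0E mulrA.
  apply: ler_wpM2r => //.
  have : 0 <= eta ^+ 2 by exact: sqr_ge0.
  by clear; rewrite mulrBr mulr1 mulrDl; lra.
have [x [cx clx]] := @rounds R J U e V V1 T N c n cw nlow M r (gam * D) (D / eta)
  (3 * (d / eta)) eta (Lam2 / D) es V1V VN Vloc nlow0 n_ge M_le cw_bnd class_cw
  class_B degV1
  eta_bnd r0 lam0 (mulr_ge0 (ltW gam0) (ltW D0)) (divr_ge0 (ltW D0) (ltW eta0))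
  r_le lam_Gam lam_Gam_r lam_r B_small Delta_small start.
exists x; split=> //; apply/forallP=> j; rewrite inE.
have [u uV ->] := chooses_in cx (in_setT j); exact: (subsetP (V1V j)).
Qed.

(** * Reduction to independent transversals *)

(** A colouring that minimises the monochromatic weight [Q]: moving [i] to the
colour [a] changes [Q] by twice the difference between the weights from [i] to
the colours [a] and [col i], so [col i] is a cheapest colour for [i]. *)
Lemma balanced_colouring (R : realType) (J : finType) (t : nat)
    (E : J -> J -> R) :
  (0 < t)%N -> (forall i j, E i j = E j i) ->
  exists col : {ffun J -> 'I_t}, forall i,
    t%:R * \sum_(j | (j != i) && (col j == col i)) E i j
      <= \sum_(j | j != i) E i j.
Proof.
move=> t0 Es.
pose Q (c : {ffun J -> 'I_t}) := \sum_k \sum_(j | (j != k) && (c j == c k)) E k j.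
pose rest (i : J) (c : {ffun J -> 'I_t}) :=
  \sum_(k | k != i) \sum_(j | [&& j != i, j != k & c j == c k]) E k j.
pose S (i : J) (a : 'I_t) (c : {ffun J -> 'I_t}) :=
  \sum_(j | (j != i) && (c j == a)) E i j.
have QE i c : Q c = rest i c + 2 * S i (c i) c.
  rewrite /Q (bigD1 i) //= -/(S i (c i) c).
  suff -> : \sum_(k | k != i) \sum_(j | (j != k) && (c j == c k)) E k j =
    rest i c + S i (c i) c by ring.
  rewrite /S big_mkcondr /= -big_split /=; apply: eq_bigr => k ki.
  rewrite (bigID (fun j => j == i)) /= addrC; congr (_ + _).
    by apply: eq_bigl => j; rewrite andbC.
  rewrite (eq_bigl (fun j => (j == i) && (c i == c k))); last first.
    move=> j; have [->|] := eqVneq j i; rewrite ?andbF // andbT eq_sym ki //.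
  rewrite big_mkcondr big_pred1_eq eq_sym.
  by case: ifP => // _; rewrite Es.
pose c0 : {ffun J -> 'I_t} := [ffun=> Ordinal t0].
pose col := [arg min_(c < c0) Q c]%O.
exists col => i.
have opt a : S i (col i) col <= S i a col.
  pose c' : {ffun J -> 'I_t} := [ffun k => if k == i then a else col k].
  have c'N k : k != i -> c' k = col k by rewrite ffunE => /negbTE ->.
  have : Q col <= Q c' by rewrite /col; case: arg_minP => // c _; apply.
  rewrite !(QE i); have -> : rest i c' = rest i col.
    apply: eq_bigr => k ki; apply: eq_bigl => j.
    by have [//|ji] := eqVneq j i; rewrite !c'N.
  have -> : S i (c' i) c' = S i a col.
    rewrite ffunE eqxx; apply: eq_bigl => j.
    by have [//|ji] := eqVneq j i; rewrite c'N.
  lra.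
have -> : \sum_(j | j != i) E i j = \sum_a S i a col.
  by rewrite (partition_big (fun j => col j) xpredT).
rewrite -[X in X%:R](card_ord t) -sum1_card natr_sum mulr_suml.
by apply: ler_sum => a _; rewrite mul1r; exact: opt.
Qed.

(** Some element can always be removed without raising the average, for instance
one with a largest value. *)
Lemma trim_below_average (R : realType) (U : finType) (f : U -> R) (a : R)
    (N : nat) (A : {set U}) :
  (N <= #|A|)%N -> \sum_(u in A) f u <= a * #|A|%:R ->
  exists B : {set U},
    [/\ B \subset A, #|B| = N & \sum_(u in B) f u <= a * N%:R].
Proof.
elim: {A}#|A| {-2}A (erefl #|A|) => [|k IH] A Ak.
  by rewrite Ak leqn0 => /eqP -> h; exists A; split.
rewrite leq_eqVlt => /orP[/eqP ->|]; first by move=> h; exists A; split.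
rewrite Ak ltnS => Nk h.
case: (pickP (fun x => (x \in A) && (\sum_(u in A :\ x) f u <= a * k%:R))).
  move=> x /andP[xA hx]; have Axk : #|A :\ x| = k.
    by move: Ak; rewrite (cardsD1 x A) xA => -[].
  have [||B [BA BN Bf]] := IH (A :\ x) Axk; rewrite ?Axk //.
  by exists B; split=> //; apply: subset_trans BA _; exact: subsetDl.
move=> H; exfalso.
set s := \sum_(u in A) f u in h.
have Hx x : x \in A -> f x <= s - a * k%:R.
  move=> xA; have := H x; rewrite xA /= => /negbT; rewrite -ltNge.
  by rewrite /s (big_setD1 _ xA) /=; lra.
have [x0 x0A] : exists x, x \in A by apply/card_gt0P; rewrite Ak.
have strict : f x0 < s - a * k%:R.
  have := H x0; rewrite x0A /= => /negbT; rewrite -ltNge.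
  by rewrite /s (big_setD1 _ x0A) /=; lra.
have : s < \sum_(u in A) (s - a * k%:R).
  rewrite {1}/s (bigD1 x0) //= [ltRHS](bigD1 x0) //=.
  by apply: ltr_leD => //; apply: ler_sum => x /andP[xA _]; exact: Hx.
rewrite sumr_const Ak -[ltRHS]mulr_natr -natr1.
rewrite -natr1 in h.
have : (a * (k%:R + 1) - s) * k%:R >= 0 by rewrite mulr_ge0 // subr_ge0.
lra.
Qed.

Lemma transversal_of_picks (T : finType) (e : rel T) (m t : nat)
    (V : 'I_m -> {set T}) (col : 'I_m -> 'I_t) (f : 'I_m -> T) :
  vertex_partition V -> (forall i, f i \in V i) ->
  (forall i j, i != j -> col i = col j -> ~~ e (f i) (f j)) ->
  exists S : {set T}, transversal_of V S /\ clique_free e t.+1 S.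
Proof.
move=> [dis _] fV ind.
have fj i j : f i \in V j -> i = j.
  move=> fij; apply/eqP/negPn/negP => ij.
  by have := disjointFr (dis i j ij) (fV i); rewrite fij.
exists (f @: setT); split.
  move=> i; rewrite (_ : _ :&: _ = [set f i]) ?cards1 //.
  apply/setP=> u; rewrite !inE; apply/andP/eqP => [[/imsetP[j _ ->] /fj -> //]|->].
  by rewrite imset_f.
move=> [K [KS Kt Kc]].
pose I := [set i | f i \in K].
have KI : K \subset f @: I.
  apply/subsetP=> u uK; have /imsetP[i _ uE] := subsetP KS u uK.
  by rewrite uE imset_f // inE -uE.
have It : (t < #|I|)%N by rewrite -Kt (leq_trans (subset_leq_card KI)) ?leq_imset_card.
have [/dinjectiveP/card_in_imset E|] := boolP (dinjectiveb col (mem I)).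
  have := max_card (mem (col @: I)).
  by rewrite card_ord leqNgt E It.
move=> /dinjectivePn[i iI [j /andP[ji jI] cij]].
rewrite !inE in iI jI.
have nij : f i != f j.
  by apply: contraNneq ji => fe; apply/eqP/fj; rewrite -fe fV.
have := ind i j; rewrite eq_sym ji => /(_ isT cij).
by rewrite Kc.
Qed.

Theorem theorem1p4 (R : realType) (eps : R) (t : nat)
    (eps_gt0 : 0 < eps) (t_gt0 : (0 < t)%N) :
  exists gamma : R, 0 < gamma /\
    forall (D : R) (T : finType) (e : rel T) (m : nat) (V : 'I_m -> {set T}),
      0 < D ->
      simple_graph e ->
      vertex_partition V ->
      (local_degree e V)%:R <= gamma * D ->
      (forall i : 'I_m, (1 + eps) * (D / t%:R) <= #|V i|%:R) ->
      (forall i : 'I_m, average_degree R e (V i) <= D) ->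
      exists S : {set T}, transversal_of V S /\ clique_free e t.+1 S.
Proof.
pose ep := Num.min eps 1.
have ep_bnd : 0 < ep <= 1 by rewrite /ep lt_min eps_gt0 ltr01 ge_min lexx orbT.
have [ep0 ep1] := andP ep_bnd.
have ep_eps : ep <= eps by rewrite /ep ge_min lexx.
have [gam0 gam0_gt0 Hcore] := core ep_bnd.
pose gam := Num.min gam0 1.
have gam_gt0 : 0 < gam by rewrite /gam lt_min gam0_gt0 ltr01.
have tR : 0 < t%:R :> R by rewrite ltr0n.
exists (gam / t%:R); split; first by rewrite divr_gt0.
move=> D0 T e m V D0_gt0 [e_sym _] Vpart Vlocal Vsize Vavg.
pose D := D0 / t%:R; have D_gt0 : 0 < D by rewrite divr_gt0.
have {}Vlocal : (local_degree e V)%:R <= gam * D.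
  by move: Vlocal; rewrite /D mulrA mulrAC.
have V_gt0 i : (0 < #|V i|)%N.
  rewrite -(ltr0n R); apply: lt_le_trans (Vsize i).
  by rewrite mulr_gt0 ?addr_gt0.
have [dis cov] := Vpart.
have same i j x : x \in V i -> x \in V j -> i = j.
  move=> xi xj; apply/eqP/negPn/negP => ij.
  by have := disjointFr (dis i j ij) xi; rewrite xj.
have [col Hcol] := @balanced_colouring R 'I_m t
  (fun i j => \sum_(v in V i) deg_to R e v (V j)) t_gt0 (fun i j => sum_deg_toC R _ _ e_sym).
pose e' : rel T := fun x y => e x y &&
  [exists i, exists j, [&& i != j, col i == col j, x \in V i & y \in V j]].
have e'_sym : symmetric e'.
  move=> x y; rewrite /e' e_sym; congr (_ && _).
  apply/existsP/existsP => -[i /existsP[j /and4P[ij c xi yj]]];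
  by exists j; apply/existsP; exists i; rewrite eq_sym ij eq_sym c yj xi.
have e'E x y i j : x \in V i -> y \in V j ->
    e' x y = [&& e x y, i != j & col i == col j].
  move=> xi yj; rewrite /e'; congr (_ && _); apply/existsP/andP.
    case=> i' /existsP[j' /and4P[ij c xi' yj']].
    by rewrite (same _ _ _ xi xi') (same _ _ _ yj yj').
  by move=> [ij c]; exists i; apply/existsP; exists j; rewrite ij c xi yj.
have V_ex v : exists i, v \in V i.
  have : v \in \bigcup_(i < m) V i by rewrite cov inE.
  by case/bigcupP=> i _ vi; exists i.
have deg_to_e' v i k : v \in V i -> deg_to R e' v (V k) =
    if (k != i) && (col k == col i) then deg_to R e v (V k) else 0.
  move=> vi; rewrite /deg_to; case: ifP => [/andP[ki cki]|kiF].
    apply: eq_bigr => u uk; rewrite (e'E _ _ i k) //.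
    by rewrite (eq_sym i) ki (eq_sym (col i)) cki /= andbT.
  rewrite big1 // => u uk; rewrite (e'E _ _ i k) //.
  by rewrite (eq_sym i) (eq_sym (col i)) kiF andbF.
have deg_to_local v k : deg_to R e' v (V k) <= gam * D.
  have [i vi] := V_ex v; rewrite (deg_to_e' _ i) //.
  case: ifP => [/andP[ki _]|_]; last by rewrite mulr_ge0 // ltW.
  apply: le_trans Vlocal.
  have -> : deg_to R e v (V k) = #|[set u in V k | e v u]|%:R.
    rewrite /deg_to -sum1_card natr_sum big_mkcond [RHS]big_mkcond /=.
    by apply: eq_bigr => u _; rewrite inE; case: (u \in V k) => //=; case: (e v u).
  rewrite ler_nat.
  apply: leq_trans (_ : degree (bipartite_between e (V i) (V k)) v <= _)%N.
    apply: subset_leq_card; apply/subsetP=> u; rewrite !inE => /andP[uk vu].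
    by rewrite /bipartite_between vu vi uk.
  apply: leq_trans (_ : max_degree (bipartite_between e (V i) (V k))
    (V i :|: V k) <= _)%N.
    by apply: leq_bigmax_cond; rewrite inE vi.
  apply: leq_trans (leq_bigmax i).
  by apply: (leq_bigmax_cond (F := fun j =>
    max_degree (bipartite_between e (V i) (V j)) (V i :|: V j))); rewrite eq_sym.
have deg_to_sub v (A B : {set T}) : A \subset B -> deg_to R e' v A <= deg_to R e' v B.
  move=> AB; rewrite /deg_to [leRHS](big_setID A) /= (setIidPr AB) lerDl.
  by apply: sumr_ge0 => u _.
have sum_parts (g : T -> R) : \sum_j \sum_(u in V j) g u = \sum_u g u.
  rewrite (exchange_big_dep xpredT) //=; apply: eq_bigr => u _.
  have [i ui] := V_ex u; rewrite (big_pred1 i) // => j /=.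
  by apply/idP/eqP => [uj|->//]; exact: same uj ui.
have degE v : \sum_j deg_to R e v (V j) = (degree e v)%:R.
  rewrite /deg_to sum_parts /degree -sum1_card natr_sum [RHS]big_mkcond /=.
  by apply: eq_bigr => u _; rewrite inE; case: (e v u).
have avg' i : \sum_(v in V i) deg_all R e' V v <= D * #|V i|%:R.
  have -> : \sum_(v in V i) deg_all R e' V v =
      \sum_(j | (j != i) && (col j == col i)) \sum_(v in V i) deg_to R e v (V j).
    rewrite [RHS]exchange_big /=; apply: eq_bigr => v vi.
    by rewrite /deg_all [RHS]big_mkcond /=; apply: eq_bigr => j _; exact: deg_to_e'.
  rewrite /D mulrAC ler_pdivlMr // mulrC; apply: le_trans (Hcol i) _.
  apply: le_trans (_ : \sum_(v in V i) (degree e v)%:R <= _).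
    rewrite exchange_big /=; apply: ler_sum => v _.
    rewrite -degE [leRHS](bigID (fun j => j != i)) /= lerDl.
    by apply: sumr_ge0 => j _; exact: deg_to_ge0.
  by move: (Vavg i); rewrite /average_degree ler_pdivrMr ?ltr0n.
(* If [D < 1], the local degree is less than 1, so that [e'] has no edges at
   all; otherwise rounding [(1 + ep) * D] up to an integer is harmless. *)
have [D_ge1|D_lt1] := lerP 1 D; last first.
  have ex i : exists x, x \in V i by exact/card_gt0P.
  apply: (@transversal_of_picks T e m t V col (fun i => xchoose (ex i))) => //.
    by move=> i; exact: xchooseP.
  move=> i j ij cij; apply/negP => eij.
  set x := xchoose (ex i) in eij; set y := xchoose (ex j) in eij.
  have xi : x \in V i by exact: xchooseP.
  have yj : y \in V j by exact: xchooseP.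
  have e'xy : e' x y by rewrite (e'E _ _ i j) // eij ij cij eqxx.
  have : 1 <= deg_to R e' x (V j).
    rewrite /deg_to (bigD1 y) //= e'xy lerDl; exact: sumr_ge0.
  have := deg_to_local x j; have : gam * D < 1 * 1.
    apply: le_lt_trans (_ : 1 * D < _); last by rewrite !mul1r.
    by rewrite ler_pM2r // /gam ge_min lexx orbT.
  lra.
have exN : exists n, (1 + ep) * D <= n%:R.
  exists (Num.bound ((1 + ep) * D)); apply/ltW/archi_boundP.
  by rewrite mulr_ge0 ?addr_ge0 ?(ltW ep0) ?(ltW D_gt0).
case: (ex_minnP exN) => N N_ge minN.
have N_le : N%:R <= 4 * D.
  case: N minN {N_ge} => [|k] minN; first by rewrite mulr_ge0 // ltW.
  have : k%:R < (1 + ep) * D.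
    by rewrite ltNge; apply/negP => /minN; rewrite ltnn.
  have : (1 + ep) * D <= 2 * D by rewrite ler_pM2r //; lra.
  by rewrite -natr1; lra.
have NV i : (N <= #|V i|)%N.
  apply: minN; apply: le_trans (Vsize i); rewrite -/D ler_pM2r //; lra.
have [V' HV'] := fin_all_exists (fun i => trim_below_average (NV i) (avg' i)).
have VV' i : V' i \subset V i by have [] := HV' i.
have [||||x [cx clx]] := Hcore D 'I_m T e' V' N D_gt0 e'_sym.
- by move=> i; have [] := HV' i.
- by rewrite N_ge.
- move=> v i; apply: le_trans (deg_to_sub v _ _ (VV' i)) _.
  apply: le_trans (deg_to_local v i) _.
  by rewrite ler_pM2r // /gam ge_min lexx.
- move=> i; have [_ _] := HV' i; apply: le_trans; apply: ler_sum => v _.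
  by apply: ler_sum => j _; exact: deg_to_sub.
have picks i : exists u, u \in V' i /\ x i = Some u.
  by have [u ? ?] := chooses_in cx (in_setT i); exists u.
have [f Hf] := fin_all_exists picks.
have fV i : f i \in V i by have [fi _] := Hf i; exact: (subsetP (VV' i)).
apply: (transversal_of_picks (col := col) (f := f)) => // i j ij cij.
have [_ xi] := Hf i; have [_ xj] := Hf j.
by have := clearP _ _ clx i j _ _ ij xi xj; rewrite (e'E _ _ i j) // ij cij eqxx /= andbT.
Qed.
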